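(* There do not exist horizontal Sobolev surfaces in the first Heisenberg group $\mathbb{H}^1$. That is, no Sobolev surface $\Sigma\subset\mathbb{H}^1$ satisfies $\mathrm{Tan}(\Sigma,y)\subset H_y\mathbb{H}^1$ for $\mathcal{H}^2_{|\cdot|}$-a.e. $y\in\Sigma$.
   Context: The Heisenberg group $\mathbb{H}^1$ is $\mathbb{R}^3$ with group operation $x\,y=x+y+(0,0,x_1y_2-x_2y_1)$ and left invariant vector fields $X_1(x)=\partial_{x_1}-x_2\partial_{x_3}$, $X_2(x)=\partial_{x_2}+x_1\partial_{x_3}$. The horizontal subspace at $y\in\mathbb{H}^1$ is $H_y\mathbb{H}^1=\{\lambda_1X_1(y)+\lambda_2X_2(y): \lambda_1,\lambda_2\in\mathbb{R}\}$. $\mathcal{H}^2_{|\cdot|}$ denotes the 2-dimensional Hausdorff measure on $\mathbb{R}^3$ with respect to the Euclidean norm $|\cdot|$. A set $S\subset\mathbb{R}^3$ is countably $\mathcal{H}^2_{|\cdot|}$-rectifiable if, up to an $\mathcal{H}^2_{|\cdot|}$-negligible set, it is contained in a countable union of images of Lipschitz maps from subsets of $\mathbb{R}^2$ to $\mathbb{R}^3$ (Euclidean metrics). A function $u\in W^{1,1}_{loc}(\Omega)$ is precisely represented if $u(x)=\lim_{r\to0^+}\frac{1}{\mathcal{L}^2(B(x,r))}\int_{B(x,r)}u\,d\mathcal{L}^2$ at every $x\in\Omega$ where this limit exists. The graph of $u:\Omega\to\mathbb{R}$, $\Omega\subset\mathbb{R}^2$ open, means the image of one of the three maps $(s,t)\mapsto(u(s,t),s,t)$,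 $(s,t)\mapsto(s,u(s,t),t)$, $(s,t)\mapsto(s,t,u(s,t))$. A Sobolev surface is a countably $\mathcal{H}^2_{|\cdot|}$-rectifiable set $S\subset\mathbb{H}^1$ that equals, up to $\mathcal{H}^2_{|\cdot|}$-negligible sets, the union of a countable nonempty family of graphs of precisely represented functions of class $W^{1,1}_{loc}$ defined on nonempty open sets of $\mathbb{R}^2$. For a countably $\mathcal{H}^2_{|\cdot|}$-rectifiable set $S$, $\mathrm{Tan}(S,y)$ is the (approximate) tangent plane, defined for $\mathcal{H}^2_{|\cdot|}$-a.e. $y\in S$: if $S$ is covered, up to an $\mathcal{H}^2_{|\cdot|}$-negligible set, by countably many embedded $C^1$ surfaces $S_j$ of $\mathbb{R}^3$, then $\mathrm{Tan}(S,y)=T_yS_j$ for $\mathcal{H}^2_{|\cdot|}$-a.e. $y\in S\cap S_j$; up to null sets this does not depend on the choice of the $S_j$. *)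

(* Defs.v *)
From mathcomp Require Import all_boot all_order all_algebra.
From mathcomp Require Import all_classical all_reals all_analysis.
Import Order.TTheory GRing.Theory Num.Theory.
Import numFieldNormedType.Exports.

Set Implicit Arguments.
Unset Strict Implicit.
Unset Printing Implicit Defensive.

Local Open Scope classical_set_scope.
Local Open Scope ring_scope.

(** The plane is [R * R], which carries the product sigma-algebra and the
    product measure; space is ['rV[R]_3].  The library norms on both are sup
    norms, so the Euclidean norms are written out. *)
Notation leb2 R :=
  (@lebesgue_measure R \x @lebesgue_measure R)%E (only parsing).

Section Euclidean.
Context {R : realType}.
Implicit Types (x : R * R) (y : 'rV[R]_3).

Definition norm2 x : R := Num.sqrt (x.1 ^+ 2 + x.2 ^+ 2).

Definition norm3 y : R := Num.sqrt (\sum_(i < 3) y 0 i ^+ 2).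

Definition ball2 x (r : R) : set (R * R) := [set z | norm2 (z - x) < r].

Definition vec3 (a b c : R) : 'rV[R]_3 := \row_(i < 3) [:: a; b; c]`_i.

End Euclidean.

Section Heisenberg.
Context {R : realType}.
Implicit Types x y v : 'rV[R]_3.

Definition hmul x y : 'rV[R]_3 :=
  x + y + vec3 0 0 (x 0 0 * y 0 1 - x 0 1 * y 0 0).

Definition X1 x : 'rV[R]_3 := vec3 1 0 (- x 0 1).

Definition X2 x : 'rV[R]_3 := vec3 0 1 (x 0 0).

(** [X1 x] and [X2 x] are the derivatives at the identity of the left
    translation by [x] along the first two coordinate axes. *)
Lemma hmul_X1 x (t : R) : hmul x (vec3 t 0 0) = x + t *: X1 x.
Proof.
rewrite /hmul -addrA; congr (_ + _); apply/rowP => -[[|[|[|//]]] i3];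
  by rewrite !mxE /= ?mulr0 ?mulr1 ?addr0 ?add0r ?sub0r ?mulrN // mulrC.
Qed.

Lemma hmul_X2 x (t : R) : hmul x (vec3 0 t 0) = x + t *: X2 x.
Proof.
rewrite /hmul -addrA; congr (_ + _); apply/rowP => -[[|[|[|//]]] i3];
  by rewrite !mxE /= ?mulr0 ?mulr1 ?addr0 ?add0r ?subr0 // mulrC.
Qed.

Definition horizontal_space y : set 'rV[R]_3 :=
  [set v | exists l1 l2 : R, v = l1 *: X1 y + l2 *: X2 y].

End Heisenberg.

Section Hausdorff.
Context {R : realType}.
Implicit Types (A E : set 'rV[R]_3) (P : 'rV[R]_3 -> Prop).

(** The added [0] makes the diameter of the empty set [0] and not [-oo]. *)
Definition diam3 A : \bar R :=
  ereal_sup ([set 0%E] `|` [set (norm3 (p.1 - p.2))%:E | p in A `*` A]).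

(** [pi / 4] is the area of a disc of diameter [1]. *)
Definition hausdorff2_pre (delta : R) E : \bar R :=
  ereal_inf [set (\sum_(0 <= i <oo) ((pi / 4)%:E * diam3 (C i) ^+ 2))%E
            | C in [set C : nat -> set 'rV[R]_3 |
                E `<=` \bigcup_i C i /\
                forall i, (diam3 (C i) <= delta%:E)%E]].

Definition hausdorff2 E : \bar R :=
  ereal_sup [set hausdorff2_pre delta E | delta in [set d : R | 0 < d]].

Definition hausdorff2_ae A P : Prop := hausdorff2 (A `&` ~` P) = 0%E.

Definition rectifiable2 A : Prop :=
  exists (D : nat -> set (R * R)) (f : nat -> R * R -> 'rV[R]_3),
    (forall i, exists L : R, forall x x', D i x -> D i x' ->
        norm3 (f i x - f i x') <= L * norm2 (x - x')) /\
    hausdorff2 (A `\` \bigcup_i (f i @` D i)) = 0%E.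

End Hausdorff.

Section Sobolev.
Context {R : realType}.
Implicit Types (Omega : set (R * R)) (u v g phi : R * R -> R).

Fixpoint class_C (n : nat) phi : Prop :=
  if n is m.+1 then
    [/\ forall x, derivable phi x (1, 0) /\ derivable phi x (0, 1),
        class_C m ('D_(1, 0) phi) & class_C m ('D_(0, 1) phi)]
  else continuous phi.

Definition test_function Omega phi : Prop :=
  [/\ forall n, class_C n phi,
      compact (closure [set x | phi x != 0]) &
      closure [set x | phi x != 0] `<=` Omega].

Definition loc_integrable Omega v : Prop :=
  forall K, compact K -> K `<=` Omega -> (leb2 R).-integrable K (EFin \o v).

Definition weak_derivative Omega (e : R * R) v g : Prop :=
  forall phi, test_function Omega phi ->
    \int[leb2 R]_(x in Omega) (v x * 'D_e phi x) =
    - \int[leb2 R]_(x in Omega) (g x * phi x).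

(** Library measurability is Borel measurability, whereas a precisely
    represented function is in general only Lebesgue measurable; hence the
    Borel function [v] almost everywhere equal to [u]. *)
Definition sobolev11_loc Omega u : Prop :=
  exists v g1 g2,
    [/\ {ae leb2 R, forall x, Omega x -> u x = v x},
        [/\ loc_integrable Omega v, loc_integrable Omega g1
          & loc_integrable Omega g2],
        weak_derivative Omega (1, 0) v g1 &
        weak_derivative Omega (0, 1) v g2].

(** For small [r] the ball lies in [Omega], so the values of [u] outside
    [Omega] do not matter.  The integral is a supremum over Borel simple
    functions and has the expected value when [u] is only Lebesgue
    measurable. *)
Definition precisely_represented Omega u : Prop :=
  forall x, Omega x -> forall l : R,
    (\int[leb2 R]_(z in ball2 x r) u z) / fine ((leb2 R) (ball2 x r))
      @[r --> 0^'+] --> l ->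
    u x = l.

(** [k] is the position of the value of [u] among the coordinates. *)
Definition graph_map (k : 'I_3) u (x : R * R) : 'rV[R]_3 :=
  if k == 0 then vec3 (u x) x.1 x.2
  else if k == 1 then vec3 x.1 (u x) x.2
  else vec3 x.1 x.2 (u x).

Definition sobolev_surface (S : set 'rV[R]_3) : Prop :=
  rectifiable2 S /\
  exists (I : set nat) (Omega : nat -> set (R * R)) (u : nat -> R * R -> R)
         (k : nat -> 'I_3),
    let G := \bigcup_(i in I) (graph_map (k i) (u i) @` Omega i) in
    [/\ I !=set0,
        forall i, I i ->
          [/\ open (Omega i), Omega i !=set0, sobolev11_loc (Omega i) (u i)
            & precisely_represented (Omega i) (u i)],
        hausdorff2 (S `\` G) = 0%E &
        hausdorff2 (G `\` S) = 0%E].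

End Sobolev.

Section Tangent.
Context {R : realType}.
Implicit Types (M S U : set 'rV[R]_3) (V : set (R * R)).

Definition C1_on V (f : R * R -> 'rV[R]_3) : Prop :=
  forall q, V q ->
    [/\ derivable f q (1, 0), derivable f q (0, 1),
        {for q, continuous ('D_(1, 0) f)} &
        {for q, continuous ('D_(0, 1) f)}].

Definition immersion_on V (f : R * R -> 'rV[R]_3) : Prop :=
  forall q, V q -> forall a b : R,
    a *: 'D_(1, 0) f q + b *: 'D_(0, 1) f q = 0 -> a = 0 /\ b = 0.

Definition C1_surface M : Prop :=
  forall p, M p -> exists U V (f : R * R -> 'rV[R]_3) (h : 'rV[R]_3 -> R * R),
    [/\ open U /\ U p, open V, C1_on V f /\ immersion_on V f &
        [/\ f @` V = M `&` U, forall q, V q -> h (f q) = q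
          & {within M `&` U, continuous h}]].

(** Velocities at [p] of curves lying in [M]. *)
Definition tangent_space M (p : 'rV[R]_3) : set 'rV[R]_3 :=
  [set v | exists c : R -> 'rV[R]_3,
     [/\ \forall t \near (0 : R), M (c t), c 0 = p & is_derive (0 : R) (1 : R) c v]].

(** [T] is a version of the approximate tangent plane field [Tan(S, .)], which
    is determined up to a negligible subset of [S]. *)
Definition tangent_field S (T : 'rV[R]_3 -> set 'rV[R]_3) : Prop :=
  exists M : nat -> set 'rV[R]_3,
    [/\ forall j, C1_surface (M j),
        hausdorff2 (S `\` \bigcup_j M j) = 0%E &
        forall j, hausdorff2_ae (S `&` M j)
                    [set y | T y = tangent_space (M j) y]].

Definition horizontal S : Prop :=
  exists T, tangent_field S T /\
    hausdorff2_ae S [set y | T y `<=` horizontal_space y].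

End Tangent.

(* Main.v *)
(** A Sobolev function is absolutely continuous on almost every line parallel to
    the axes, with its weak derivative as classical derivative almost everywhere
    on the line, and almost every point of the line is a limit of points of the
    line over which the graph lies in the same C1 surface.  The velocity of the
    graph along the line is thus a limit of chords of that surface, hence
    horizontal, and no approximate differentiability in the plane is needed.
    Writing [(x, y)] for the parameters of the graph of [u], this forces
    [d_y u = slope x] with [slope' <> 0] away from [x = 0], and on two lines
    [y], [y'] the values of [d_x u] differ by [- slope' x * (y - y')].  But
    [u (x, y) - u (x, y') = slope x * (y - y')] has the opposite derivative. *)

Require Import Defs.
From mathcomp Require Import all_boot all_order all_algebra.
From mathcomp Require Import all_classical all_reals all_analysis.
From mathcomp Require Import measurable_realfun ring lra.
Import Order.TTheory GRing.Theory Num.Theory.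
Import numFieldNormedType.Exports.

Set Implicit Arguments.
Unset Strict Implicit.
Unset Printing Implicit Defensive.

Local Open Scope classical_set_scope.
Local Open Scope ring_scope.

(** * Hausdorff null sets and coordinate projections *)

Section HausdorffNull.
Context {R : realType}.
Implicit Types (A Z : set 'rV[R]_3) (y : 'rV[R]_3).

(** The final clash is that of mixed second derivatives, [slope'] against [- slope'], a trace of
    [[X1, X2] = 2 d_3]. A [W^{1,1}] function has no second derivatives, so the derivative in [y] is
    replaced by a difference between two lines.

    The hypotheses hold up to [hausdorff2]-null sets of space. Coordinate projections do not
    increase distances and invert the graph maps, so the exceptional parameters of any one graph
    form a Lebesgue null set, whatever the regularity of [u].

    Two obstacles shape the rest. The parameters over a given C1 surface need not form a measurable
    set, so limit points take the place of density points. And a property of almost every point on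
    almost every line in one direction passes to the lines in the other direction only when it is
    measurable. Weak derivatives are tested against countably many bumps with rational end points,
    so that the union of the exceptional sets of lines stays null. *)

Lemma coord_le_norm3 y (i : 'I_3) : `|y 0 i| <= norm3 y.
Proof.
rewrite /norm3 -sqrtr_sqr ler_sqrt ?sumr_ge0 // => [|j _]; last exact: sqr_ge0.
by rewrite (bigD1 i) //= lerDl sumr_ge0 // => j _; exact: sqr_ge0.
Qed.

Lemma diam3_ge0 A : (0 <= diam3 A)%E.
Proof. by apply: ereal_sup_ubound; left. Qed.

Lemma coord_le_diam3 A y z (i : 'I_3) : A y -> A z ->
  (`|y 0 i - z 0 i|%:E <= diam3 A)%E.
Proof.
move=> Ay Az; apply: (@le_trans _ _ (norm3 (y - z))%:E).
  by rewrite lee_fin; have := coord_le_norm3 (y - z) i; rewrite !mxE.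
by apply: ereal_sup_ubound; right; exists (y, z).
Qed.

(** Measurable covers of measure at most [1 / (n + 1)] are intersected. [N] itself may be
    nonmeasurable, as the projections below are not known to be measurable. *)
Lemma negligible_le_eps d (T : measurableType d)
    (mu : {measure set T -> \bar R}) (N : set T) :
  (forall e : R, 0 < e ->
    exists B, [/\ measurable B, N `<=` B & (mu B <= e%:E)%E]) ->
  mu.-negligible N.
Proof.
move=> H.
have /choice [B HB] : forall n : nat, exists B : set T,
    [/\ measurable B, N `<=` B & (mu B <= (n.+1%:R^-1)%:E)%E].
  by move=> n; apply: H; rewrite invr_gt0.
exists (\bigcap_n B n); split.
- by apply: bigcapT_measurable => n; have [] := HB n.
- apply/eqP; rewrite eq_le measure_ge0 andbT; apply/lee_addgt0Pr => e e0.
  rewrite add0e.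
  have [n ne] : exists n : nat, n.+1%:R^-1 < e.
    exists (Num.truncn (e^-1)); rewrite -[ltRHS]invrK ltf_pV2 ?posrE ?invr_gt0 //.
    by rewrite truncnS_gt.
  have [mB _ Bn] := HB n.
  apply: le_trans (le_trans Bn _); last by rewrite lee_fin ltW.
  apply: le_measure; rewrite ?inE //.
  - by apply: bigcapT_measurable => m; have [] := HB m.
  - exact: bigcap_inf.
- by move=> x Nx n _; have [_ + _] := HB n; exact.
Qed.

(** A set of diameter [r] projects into the square of half side [r] about the image of any of its
    points, whence the factor 4. The bound by 1 makes the diameter a real number. *)
Lemma subset_square A (i j : 'I_3) : (diam3 A <= 1)%E ->
  exists B : set (measurableTypeR R * measurableTypeR R),
    [/\ measurable B, (fun y => (y 0 i, y 0 j)) @` A `<=` B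
      & ((leb2 R) B <= 4%:E * diam3 A ^+ 2)%E].
Proof.
move=> dA; have [->|/set0P[y Ay]] := eqVneq A set0.
  exists set0; split => //; first by move=> ? [].
  by rewrite measure0 mule_ge0 // expe_ge0 // diam3_ge0.
have dE : diam3 A = (fine (diam3 A))%:E.
  rewrite fineK // ge0_fin_numE ?diam3_ge0 //.
  by apply: le_lt_trans dA _; rewrite ltry.
set r := fine _ in dE.
have r0 : 0 <= r by rewrite -lee_fin -dE diam3_ge0.
exists (`[y 0 i - r, y 0 i + r] `*` `[y 0 j - r, y 0 j + r]); split.
- by apply: measurableX; exact: measurable_itv.
- move=> _ [z Az <-]; split => /=; rewrite in_itv /=.
  + by have := coord_le_diam3 i Az Ay; rewrite dE lee_fin ler_distl.
  + by have := coord_le_diam3 j Az Ay; rewrite dE lee_fin ler_distl.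
- have len (a : R) : lebesgue_measure `[a - r, a + r] = (2 * r)%:E.
    rewrite lebesgue_measure_itv /= lte_fin; rewrite -EFinB.
    by case: ltP => ? ; congr EFin; lra.
  apply: (@le_trans _ _ ((2 * r)%:E * (2 * r)%:E)%E).
    rewrite product_measure1E; [|exact: measurable_itv..].
    by rewrite le_eqVlt; apply/orP; left; apply/eqP; congr (_ * _)%E; exact: len.
  by rewrite dE -EFin_expe -!EFinM lee_fin; lra.
Qed.

Lemma hausdorff2_null_projection Z (i j : 'I_3) : hausdorff2 Z = 0%E ->
  (leb2 R).-negligible ((fun y => (y 0 i, y 0 j)) @` Z).
Proof.
move=> Z0; apply: negligible_le_eps => e e0.
have pi4 : 0 < pi / 4 :> R by rewrite divr_gt0 ?pi_gt0.
(* The level [delta = 1] suffices. The factor [pi / 4] is that of the premeasure, and [e / 4]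
   compensates the area factor 4 of the squares. *)
have : (hausdorff2_pre 1 Z < ((pi / 4) * (e / 4))%:E)%E.
  apply: (@le_lt_trans _ _ 0%E).
    by rewrite -Z0; apply: ereal_sup_ubound; exists 1 => //=; exact: ltr01.
  by rewrite lte_fin mulr_gt0 // divr_gt0.
case/ereal_inf_lt => _ [C [ZC dC] <-].
rewrite nneseriesZl; last by move=> n _; rewrite expe_ge0 // diam3_ge0.
rewrite [X in (_ < X)%E]EFinM lte_pmul2l // => Ce.
have /choice [B HB] := fun n => subset_square i j (dC n).
exists (\bigcup_n B n); split.
- by apply: bigcupT_measurable => n; have [] := HB n.
- move=> _ [y /ZC [n _ Cy] <-]; exists n => //.
  by have [_ + _] := HB n; apply; exists y.
- apply: (le_trans (le_mu_bigcup (leb2 R) _ _)) => [n||].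
  + by have [] := HB n.
  + by apply: bigcupT_measurable => n; have [] := HB n.
  apply: (@le_trans _ _ (\sum_(0 <= n <oo) 4%:E * diam3 (C n) ^+ 2)%E).
    by apply: lee_nneseries => n *; have [] := HB n.
  rewrite nneseriesZl; last by move=> n _; rewrite expe_ge0 // diam3_ge0.
  rewrite -lee_pdivlMl // -EFinM; apply: ltW; apply: lt_le_trans Ce _.
  by rewrite lee_fin mulrC.
Qed.

End HausdorffNull.

(** * Chords of embedded C1 surfaces *)

Section C1Surfaces.
Context {R : realType}.

Lemma is_derive_line (V W : normedModType R) (f : V -> W) (x v : V) (t : R) :
  derivable f (x + t *: v) v ->
  is_derive t 1 (fun h : R => f (x + h *: v)) ('D_v f (x + t *: v)).
Proof.
move=> df.
have E : (fun h : R => h^-1 *: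
    (((fun h => f (x + h *: v)) \o shift t) (h *: 1) - f (x + t *: v))) =
  (fun h => h^-1 *: ((f \o shift (x + t *: v)) (h *: v) - f (x + t *: v))).
  apply/funext => h /=; do 3 congr (_ _); rewrite [h *: 1]mulr1 scalerDl.
  by rewrite addrCA.
by split; rewrite /derivable /derive E.
Qed.

(** The increment [a] may have either sign; [|c| <= |a|] is the form in which the intermediate point
    stays in a small ball. *)
Lemma MVT_line (V : normedModType R) (f : V -> R) (x v : V) (a : R) :
  (forall s : R, `|s| <= `|a| -> derivable f (x + s *: v) v) ->
  exists2 c : R, `|c| <= `|a| &
    f (x + a *: v) - f x = a * 'D_v f (x + c *: v).
Proof.
move=> df; pose g (h : R) := f (x + h *: v).
have dg (s : R) : `|s| <= `|a| -> is_derive s (1 : R) g ('D_v f (x + s *: v)).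
  by move=> sa; apply: is_derive_line; exact: df.
have -> : f x = g 0 by rewrite /g scale0r addr0.
rewrite -/(g a); have [a0|a0] := leP 0 a.
- have sa s : 0 <= s -> s <= a -> `|s| <= `|a| by move=> *; rewrite !ger0_norm.
  have [||c] := @MVT_segment R g (fun s => 'D_v f (x + s *: v)) 0 a a0.
  + move=> s; rewrite in_itv /= => /andP[s0 s1]; apply/dg/sa; exact: ltW.
  + apply: derivable_within_continuous => s; rewrite in_itv /= => /andP[s0 s1].
    by have [] := dg _ (sa _ s0 s1).
  + rewrite in_itv /= => /andP[c0 c1] ->; exists c; first exact: sa.
    by rewrite subr0 mulrC.
- have sa s : a <= s -> s <= 0 -> `|s| <= `|a|.
    by move=> *; rewrite !ler0_norm ?lerN2 // ltW.
  have [|||c] := @MVT_segment R g (fun s => 'D_v f (x + s *: v)) a 0.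
  + exact: ltW.
  + move=> s; rewrite in_itv /= => /andP[s0 s1]; apply/dg/sa; exact: ltW.
  + apply: derivable_within_continuous => s; rewrite in_itv /= => /andP[s0 s1].
    by have [] := dg _ (sa _ s0 s1).
  + rewrite in_itv /= => /andP[c0 c1] E; exists c; first exact: sa.
    by rewrite -opprB E sub0r mulrN opprK mulrC.
Qed.

(** The path from [q] to [q + w] goes along the second axis and then along the first. On each leg
    the mean value theorem applies, and the partial derivatives met there are within [e] of those at
    [q]. *)
Lemma C1_increment (V : set (R * R)) (f : R * R -> R) (q : R * R) (e : R) :
  open V -> V q ->
  (forall x, V x -> derivable f x (1, 0) /\ derivable f x (0, 1)) ->
  {for q, continuous ('D_(1, 0) f)} -> {for q, continuous ('D_(0, 1) f)} ->
  0 < e -> exists2 d, 0 < d & forall w : R * R, `|w.1| < d -> `|w.2| < d ->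
    `|f (q + w) - f q - (w.1 * 'D_(1, 0) f q + w.2 * 'D_(0, 1) f q)|
      <= e * (`|w.1| + `|w.2|).
Proof.
move=> oV Vq df c1 c2 e0.
have /nbhs_ballP[d d0 H] : \forall z \near q, V z /\
    (`|'D_(1, 0) f q - 'D_(1, 0) f z| <= e /\
     `|'D_(0, 1) f q - 'D_(0, 1) f z| <= e).
  apply: filterI; first exact: open_nbhs_nbhs.
  by apply: filterI; [move: c1|move: c2] => /cvgrPdist_le; apply.
have {}H (a b : R) : `|a| < d -> `|b| < d -> V (q + (a, b)) /\
    (`|'D_(1, 0) f (q + (a, b)) - 'D_(1, 0) f q| <= e /\
     `|'D_(0, 1) f (q + (a, b)) - 'D_(0, 1) f q| <= e).
  move=> ad bd; rewrite distrC [in X in _ /\ (_ /\ X)]distrC; apply: H.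
  by split => /=; rewrite -ball_normE /= opprD addNKr normrN.
exists d => // -[a b] /= ad bd.
have gen (x y : R) : `|x| <= e -> `|y| <= e ->
    `|a * x + b * y| <= e * (`|a| + `|b|).
  move=> xe ye; apply: (le_trans (ler_normD _ _)).
  by rewrite !normrM mulrDr ![e * _]mulrC lerD // ler_wpM2l.
have Ea s : (0, b) + s *: (1, 0) = (s, b) :> R * R.
  by congr (_, _) => /=; rewrite ?scaler0 ?add0r ?addr0 // [_ *: _]mulr1.
have Eb s : s *: (0, 1) = (0, s) :> R * R.
  by congr (_, _) => /=; rewrite ?scaler0 // [_ *: _]mulr1.
have [s sa] : exists2 s : R, `|s| <= `|a| &
    f (q + (0, b) + a *: (1, 0)) - f (q + (0, b)) =
      a * 'D_(1, 0) f (q + (0, b) + s *: (1, 0)).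
  apply: MVT_line => s sa; rewrite -addrA Ea; apply: (df _ _).1.
  by have [] := H s b (le_lt_trans sa ad) bd.
rewrite -!addrA !Ea => E1.
have [t tb] : exists2 t : R, `|t| <= `|b| &
    f (q + b *: (0, 1)) - f q = b * 'D_(0, 1) f (q + t *: (0, 1)).
  apply: MVT_line => r rb; rewrite Eb; apply: (df _ _).2.
  by have [] := H 0 r _ (le_lt_trans rb bd); rewrite // normr0.
rewrite !Eb => E2.
have [_ [H1 _]] := H s b (le_lt_trans sa ad) bd.
have [_ [_ H2]] : V (q + (0, t)) /\
    (`|'D_(1, 0) f (q + (0, t)) - 'D_(1, 0) f q| <= e /\
     `|'D_(0, 1) f (q + (0, t)) - 'D_(0, 1) f q| <= e).
  by apply: H; rewrite ?normr0 //; exact: le_lt_trans bd.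
set L := (X in `|X|).
have -> : L =
    a * ('D_(1, 0) f (q + (s, b)) - 'D_(1, 0) f q)
    + b * ('D_(0, 1) f (q + (0, t)) - 'D_(0, 1) f q).
  by rewrite /L !mulrBr -E1 -E2; ring.
exact: (gen _ _ H1 H2).
Qed.


(** The matrix with rows [A] and [B] has full row rank, hence a right inverse [L], and [(a, b)] is
    recovered as [(a A + b B) L]. [K] is the sum of the absolute values of the entries of [L], plus
    1 to make it positive. *)
Lemma independent_coord_bound (A B : 'rV[R]_3) :
  (forall a b : R, a *: A + b *: B = 0 -> a = 0 /\ b = 0) ->
  exists2 K, 0 < K & forall a b : R,
    `|a| + `|b| <= K * \sum_(i < 3) `|a * A 0 i + b * B 0 i|.
Proof.
move=> AB.
have : row_free (col_mx A B).
  rewrite -kermx_eq0; apply/eqP/row_matrixP => i; rewrite row0.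
  have : row i (kermx (col_mx A B)) *m col_mx A B = 0.
    by rewrite -row_mul mulmx_ker row0.
  set u := row i _; rewrite -[u]hsubmxK mul_row_col.
  rewrite [lsubmx u]mx11_scalar [rsubmx u]mx11_scalar !mul_scalar_mx.
  by move=> /AB[-> ->]; rewrite raddf0 row_mx0.
case/row_freeP => L LE.
pose S : R := \sum_(i < 3) (`|L i (lshift 1 0)| + `|L i (rshift 1 0)|).
have S0 : 0 <= S by apply: sumr_ge0 => i _; rewrite addr_ge0.
exists (S + 1); first by rewrite ltr_wpDl.
move=> a b; pose u : 'rV[R]_(1 + 1) := row_mx a%:M b%:M.
have Eu j : u 0 j = \sum_i (a * A 0 i + b * B 0 i) * L i j.
  rewrite -[u]mulmx1 -LE mulmxA mul_row_col !mul_scalar_mx mxE.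
  by apply: eq_bigr => i _; rewrite !mxE.
have := Eu (lshift 1 0); have := Eu (rshift 1 0).
rewrite row_mxEl row_mxEr !mxE !mulr1n => Eb Ea.
rewrite [X in `|X| + _]Ea [X in _ + `|X| <= _]Eb mulr_sumr.
apply: (le_trans (lerD (ler_norm_sum _ _ _) (ler_norm_sum _ _ _))).
rewrite -big_split /=; apply: ler_sum => i _.
rewrite !normrM -mulrDr mulrC ler_wpM2r //.
rewrite -lerBlDr; apply: (@le_trans _ _ (`|L i (lshift 1 0)| + `|L i (rshift 1 0)|)).
  by rewrite lerBlDr lerDl.
by rewrite /S (bigD1 i) //= lerDl sumr_ge0 // => k _; rewrite addr_ge0.
Qed.

(* [dx_3 + x_2 dx_1 - x_1 dx_2] in 1-based coordinates. *)
Definition contact_form (p v : 'rV[R]_3) : R :=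
  v 0 2 + p 0 1 * v 0 0 - p 0 0 * v 0 1.

Lemma contact_form_horizontal (p v : 'rV[R]_3) :
  horizontal_space p v -> contact_form p v = 0.
Proof.
move=> [l1 [l2 ->]]; rewrite /contact_form !mxE /=; ring.
Qed.

Lemma derive_coord (V : normedModType R) (f : V -> 'rV[R]_3) x v i :
  derivable f x v ->
  derivable (fun z => f z 0 i) x v /\
  'D_v (fun z => f z 0 i) x = ('D_v f x) 0 i.
Proof.
move=> df; split; first exact: (derivable_mxP f x v).1.
by rewrite derive_mx // mxE.
Qed.

Lemma C1_on_increment (V : set (R * R)) (f : R * R -> 'rV[R]_3) q (e : R) :
  open V -> V q -> C1_on V f -> 0 < e ->
  exists2 d, 0 < d & forall (w : R * R) (i : 'I_3), `|w.1| < d -> `|w.2| < d ->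
    `|f (q + w) 0 i - f q 0 i
        - (w.1 * ('D_(1, 0) f q) 0 i + w.2 * ('D_(0, 1) f q) 0 i)|
      <= e * (`|w.1| + `|w.2|).
Proof.
move=> oV Vq Cf e0.
have /choice [d dP] : forall i : 'I_3, exists d, 0 < d /\
    forall w : R * R, `|w.1| < d -> `|w.2| < d ->
    `|f (q + w) 0 i - f q 0 i
        - (w.1 * ('D_(1, 0) f q) 0 i + w.2 * ('D_(0, 1) f q) 0 i)|
      <= e * (`|w.1| + `|w.2|).
  move=> i; have [d1 d2 c1 c2] := Cf q Vq.
  have cc v : (forall z, V z -> derivable f z v) ->
      {for q, continuous ('D_v f)} ->
      {for q, continuous ('D_v (fun z => f z 0 i))}.
    move=> dv cv.
    have E : {near q, (fun z => ('D_v f z) 0 i) =1 'D_v (fun z => f z 0 i)}.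
      near=> z; have Vz : V z by near: z; exact: open_nbhs_nbhs.
      by have [_ ->] := derive_coord i (dv z Vz).
    rewrite /prop_for /continuous_at; have [_ ->] := derive_coord i (dv q Vq).
    apply: cvg_trans (near_eq_cvg E) _.
    exact: (continuous_comp cv (@coord_continuous _ _ _ 0 i _)).
  have D1 z : V z -> derivable f z (1, 0) by case/Cf.
  have D2 z : V z -> derivable f z (0, 1) by case/Cf.
  have [|||d d0 H] := C1_increment (f := fun z => f z 0 i) oV Vq _ _ _ e0.
  - move=> z Vz; split; first exact: (derive_coord i (D1 z Vz)).1.
    exact: (derive_coord i (D2 z Vz)).1.
  - exact: (cc _ D1 c1).
  - exact: (cc _ D2 c2).
  exists d; split => // w wd1 wd2.
  have := H w wd1 wd2.
  by have [_ ->] := derive_coord i d1; have [_ ->] := derive_coord i d2.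
exists (Num.min (d 0) (Num.min (d 1) (d 2))).
  by rewrite !lt_min; apply/and3P; split; have [] := dP 0; have [] := dP 1;
    have [] := dP 2.
move=> w i; rewrite !lt_min => /and3P[a0 a1 a2] /and3P[b0 b1 b2].
have [_ H0] := dP 0; have [_ H1] := dP 1; have [_ H2] := dP 2.
case: i => [[|[|[|//]]] i3].
- by rewrite (_ : Ordinal i3 = 0) ?H0 //; exact/val_inj.
- by rewrite (_ : Ordinal i3 = 1) ?H1 //; exact/val_inj.
- by rewrite (_ : Ordinal i3 = 2) ?H2 //; exact/val_inj.
Unshelve. all: by end_near. Qed.


(** The image of a straight line through [q] is a curve in [M] for small times, because [V] is
    open. *)
Lemma tangent_space_partial M U (V : set (R * R)) (f : R * R -> 'rV[R]_3) q v :
  open V -> V q -> f @` V = M `&` U -> derivable f q v ->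
  tangent_space M (f q) ('D_v f q).
Proof.
move=> oV Vq fV df; exists (fun t : R => f (q + t *: v)); split.
- have : \forall t \near (0 : R), V (q + t *: v).
    have cl : {for 0, continuous (fun t : R => q + t *: v)}.
      apply: cvgD; first exact: cvg_cst.
      by apply: cvgZr_tmp; exact: cvg_id.
    apply: cl; rewrite scale0r addr0; exact: open_nbhs_nbhs.
  apply: filterS => t Vt; suff : (M `&` U) (f (q + t *: v)) by case.
  by rewrite -fV; exists (q + t *: v).
- by rewrite scale0r addr0.
- have E : q + (0 : R) *: v = q by rewrite scale0r addr0.
  have dE : derivable f (q + (0 : R) *: v) v by rewrite E.
  by have := is_derive_line dE; rewrite E.
Qed.

Lemma is_derive_increment (g : R -> 'rV[R]_3) d (e : R) :
  is_derive (0 : R) (1 : R) g d -> 0 < e ->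
  \forall t \near (0 : R), forall i, `|g t 0 i - g 0 0 i - t * d 0 i| <= e * `|t|.
Proof.
move=> [dg gd] e0; have /cvg_ex[l gl] := dg.
have ld : l = d by rewrite -gd; apply/esym/cvg_lim.
rewrite ld in gl; move/cvgrPdist_le : gl => /(_ _ e0) /nbhs_ballP[r r0 H].
apply/nbhs_ballP; exists r => // t rt i.
have [->|t0] := eqVneq t 0.
  by rewrite subrr mul0r subr0 normr0 mulr0.
have := H t rt t0; rewrite /= addr0 [t *: 1]mulr1 => Ht.
have Hi : `|(d - t^-1 *: (g t - g 0)) 0 i| <= e.
  apply: le_trans Ht; rewrite [leRHS]/Num.Def.normr/= mx_normrE.
  exact: (le_bigmax _ (fun k : 'I_1 * 'I_3 => `|(d - t^-1 *: (g t - g 0)) k.1 k.2|) (0, i)).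
have -> : g t 0 i - g 0 0 i - t * d 0 i = - t * (d - t^-1 *: (g t - g 0)) 0 i.
  by rewrite !mxE; field.
by rewrite normrM normrN mulrC ler_wpM2r.
Qed.

(** [6 K e <= 1] makes the last term at most [S / 2], which is moved to the left-hand side and
    accounts for the factor 2; [e <= 1] bounds [3 e T] by [3 T]. *)
Lemma absorb_error (K e T D S : R) : S <= K * (T * D + 3 * (e * T) + 3 * (e * S)) ->
  0 < K -> 0 <= T -> 0 <= S -> e <= 1 -> 6 * K * e <= 1 ->
  S <= 2 * K * (T * (D + 3)).
Proof.
move=> H K0 T0 S0 e1 Ke.
have K1 : 3 * K * e * S <= 1 / 2 * S by rewrite ler_wpM2r //; lra.
have K2 : (K * T) * (3 * e) <= (K * T) * 3.
  by rewrite ler_wpM2l //; [rewrite mulr_ge0 // ltW|lra].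
lra.
Qed.

(* The embedding makes the parameters of nearby points of [M] comparable to
   their distance from [p], so chords of [M] at [p] are horizontal to first
   order. *)
Lemma velocity_horizontal M (g : R -> 'rV[R]_3) d :
  C1_surface M -> M (g 0) ->
  tangent_space M (g 0) `<=` horizontal_space (g 0) ->
  is_derive (0 : R) (1 : R) g d ->
  (forall e : R, 0 < e -> exists t, [/\ t != 0, `|t| < e & M (g t)]) ->
  contact_form (g 0) d = 0.
Proof.
move=> CM Mp TH dg acc; set p := g 0 in Mp TH *.
have [U [V [f [h [[oU Up] oV [Cf If] [fV hf ch]]]]]] := CM _ Mp.
have [q Vq fq] : (f @` V) p by rewrite fV.
have hp : h p = q by rewrite -fq hf.
have [d1 d2 _ _] := Cf _ Vq.
have HA : contact_form p ('D_(1, 0) f q) = 0.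
  apply/contact_form_horizontal/TH; rewrite -fq.
  exact: (tangent_space_partial oV Vq fV).
have HB : contact_form p ('D_(0, 1) f q) = 0.
  apply/contact_form_horizontal/TH; rewrite -fq.
  exact: (tangent_space_partial oV Vq fV).
have [K K0 HK] := independent_coord_bound (If _ Vq).
set A := 'D_(1, 0) f q in HA HK; set B := 'D_(0, 1) f q in HB HK.
pose C := 1 + `|p 0 1| + `|p 0 0|.
have C0 : 0 < C by rewrite /C -addrA ltr_pwDl // addr_ge0.
have Cbnd (v : 'rV[R]_3) e : (forall i, `|v 0 i| <= e) -> `|contact_form p v| <= C * e.
  move=> ve; rewrite /contact_form /C !mulrDl mul1r.
  apply: (le_trans (ler_normB _ _)); rewrite lerD //.
    by apply: (le_trans (ler_normD _ _)); rewrite lerD // normrM ler_wpM2l.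
  by rewrite normrM ler_wpM2l.
pose D := \sum_(i < 3) `|d 0 i|.
have D0 : 0 <= D by exact: sumr_ge0.
(* The estimate for all small [e] gives the claim as [e] tends to 0. The two upper bounds on [e] are
   those of [absorb_error]. *)
suff main e : 0 < e -> e <= 1 -> 6 * K * e <= 1 ->
    `|contact_form p d| <= C * e * (1 + 2 * K * (D + 3)).
  apply/eqP; rewrite -normr_eq0 eq_le normr_ge0 andbT.
  apply/ler_addgt0Pr => e e0; rewrite add0r.
  pose Q := C * (1 + 2 * K * (D + 3)).
  have Q0 : 0 < Q by rewrite /Q mulr_gt0 // ltr_pwDl // !mulr_ge0 ?addr_ge0 // ltW.
  pose e' := Num.min 1 (Num.min ((6 * K)^-1) (e / Q)).
  have [e1 e2 e3] : [/\ e' <= 1, e' <= (6 * K)^-1 & e' <= e / Q].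
    by rewrite /e' !ge_min !lexx !orbT.
  have e'0 : 0 < e' by rewrite !lt_min ltr01 invr_gt0 mulr_gt0 //= divr_gt0.
  apply: le_trans (main e' e'0 e1 _) _.
    by rewrite -ler_pdivlMl ?mulr1 // mulr_gt0.
  by rewrite mulrAC mulrC -ler_pdivlMr.
move=> e0 e1 e2.
have [r r0 Hr] := C1_on_increment oV Vq Cf e0.
(* This is where the embedding enters: an immersion alone could return to [p] from a distant
   parameter. *)
have near_q : \forall y \near p, M y -> U y -> `|h y - q| < r.
  have MUp : (M `&` U) p by [].
  have := (subspace_continuousP (M `&` U) h).1 ch p MUp.
  move=> /cvgrPdist_lt /(_ _ r0); rewrite near_withinE.
  by apply: filterS => y H My Uy; rewrite distrC -hp; exact: H.
have cg : {for 0, continuous g}.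
  by apply: differentiable_continuous; apply/derivable1_diffP; case: dg.
have [s s0 Hs] : exists2 s, 0 < s & forall t : R, `|t| < s -> [/\
    (M (g t) -> U (g t) -> `|h (g t) - q| < r), U (g t) &
    (forall i, `|g t 0 i - p 0 i - t * d 0 i| <= e * `|t|)].
  have : \forall t \near (0 : R), (M (g t) -> U (g t) -> `|h (g t) - q| < r) /\
    (U (g t) /\ (forall i, `|g t 0 i - p 0 i - t * d 0 i| <= e * `|t|)).
    apply: filterI; first exact: (cg _ near_q).
    apply: filterI; first by apply: (cg U); exact: open_nbhs_nbhs.
    exact: is_derive_increment.
  case/nbhs_ballP => s s0 H; exists s => // t ts.
  by have [] := H t; [rewrite -ball_normE /= sub0r normrN|move=> ? []; split].
have [t [t0 ts Mt]] := acc _ s0.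
have [/(_ Mt) qt Ut gt] := Hs _ ts.
have {}qt := qt Ut.
have [z Vz fz] : (f @` V) (g t) by rewrite fV.
have hz : h (g t) = z by rewrite -fz hf.
rewrite hz in qt; pose w := z - q.
have [w1 w2] : `|w.1| < r /\ `|w.2| < r.
  by split; apply: le_lt_trans qt; rewrite [leRHS]/Num.norm /= le_max lexx ?orbT.
have {}Hr i := Hr w i w1 w2.
have qw : q + w = z by rewrite addrC subrK.
pose a := w.1; pose b := w.2; pose S := `|a| + `|b|.
have {}Hr i : `|g t 0 i - p 0 i - (a * A 0 i + b * B 0 i)| <= e * S.
  by have := Hr i; rewrite qw fz fq.
have t00 : 0 < `|t| by rewrite normr_gt0.
(* The chord is [t *: d] up to [e |t|] and [a *: A + b *: B] up to [e S] in each coordinate, so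
   independence of [A] and [B] makes the displacement [S] of the parameter of order [|t|]. *)
have S1 : S <= 2 * K * (`|t| * (D + 3)).
  suff : S <= K * (`|t| * D + 3 * (e * `|t|) + 3 * (e * S)).
    by move/absorb_error; apply; rewrite ?addr_ge0.
    apply: le_trans (HK a b) _; rewrite ler_pM2l //.
    have -> : `|t| * D + 3 * (e * `|t|) + 3 * (e * S) =
        \sum_(i < 3) (`|t| * `|d 0 i| + e * `|t| + e * S).
      by rewrite !big_split /= -mulr_sumr !sumr_const card_ord !mulr_natl.
    apply: ler_sum => i _.
    have := Hr i; have := gt i; have := normrM t (d 0 i).
    rewrite -/p; move: (g t 0 i - p 0 i) (a * A 0 i + b * B 0 i) (t * d 0 i).
    move=> x y u u1 xu xy; rewrite -u1.
    have -> : y = u + (x - u) - (x - y) by ring.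
    apply: le_trans (ler_normB _ _) _; rewrite lerD //.
    by apply: le_trans (ler_normD _ _) _; rewrite lerD.
move: (g t) gt Hr => y gt Hr; clearbody A B p.
(* [contact_form p] is linear in the vector and vanishes on [A] and [B], so that only the error of
   the chart and the error of the curve remain. *)
have tv : `|t * contact_form p d| <= C * (e * `|t|) + C * (e * S).
  have -> : t * contact_form p d =
    contact_form p (y - p - (a *: A + b *: B))
    - contact_form p (y - p - t *: d).
    move: HA HB; rewrite /contact_form !mxE => HA HB.
    have -> : A 0 2 = p 0 0 * A 0 1 - p 0 1 * A 0 0 by lra.
    have -> : B 0 2 = p 0 0 * B 0 1 - p 0 1 * B 0 0 by lra.
    ring.
  apply: le_trans (ler_normB _ _) _; rewrite addrC lerD //; apply: Cbnd => i.
  - by have := gt i; rewrite !mxE.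
  - by have := Hr i; rewrite !mxE.
rewrite -(ler_pM2l t00) -normrM; apply: le_trans tv _.
have -> : `|t| * (C * e * (1 + 2 * K * (D + 3))) =
   C * (e * `|t|) + C * (e * (2 * K * (`|t| * (D + 3)))) by ring.
by rewrite lerD2l !ler_pM2l.
Qed.

End C1Surfaces.

(** * Smooth bump functions *)

Section SmoothFunctions.
Context {R : realType}.
Implicit Types (f g : R -> R).

Lemma is_derive1_comp f g (x df dg : R) :
  is_derive x 1 f df -> is_derive (f x) 1 g dg ->
  is_derive x 1 (fun z => g (f z)) (dg * df).
Proof.
move=> [f1 f2] [g1 g2]; split.
  apply/derivable1_diffP; apply: differentiable_comp.
    exact/derivable1_diffP.
  exact/derivable1_diffP.
have := derive1_comp f1 g1; rewrite !derive1E => E.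
by rewrite -f2 -g2; exact: E.
Qed.

(** Derivatives are carried as witnesses, so that sums, products and affine substitutions are
    treated by induction without computing iterated derivatives. Level 0 demands nothing, not even
    continuity. *)
Fixpoint smooth_upto (n : nat) f : Prop :=
  if n is m.+1 then
    exists2 f', (forall x : R, is_derive x 1 f (f' x)) & smooth_upto m f'
  else True.

Definition smooth f := forall n, smooth_upto n f.

Lemma smooth_uptoS n f : smooth_upto n.+1 f -> smooth_upto n f.
Proof.
elim: n f => [//|n IH] f [f' df sf]; exists f' => //; exact: IH.
Qed.

Lemma smooth_upto_cst n (c : R) : smooth_upto n (fun=> c).
Proof.
elim: n c => [//|n IH] c; exists (fun=> 0); last exact: IH.
by move=> x; exact: is_derive_cst.
Qed.

Lemma smooth_uptoD n f g :
  smooth_upto n f -> smooth_upto n g -> smooth_upto n (fun x => f x + g x).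
Proof.
elim: n f g => [//|n IH] f g [f' df sf] [g' dg sg].
exists (fun x => f' x + g' x); last exact: IH.
by move=> x; exact: (@is_deriveD _ _ _ f g x 1 _ _ (df x) (dg x)).
Qed.

Lemma smooth_uptoM n f g :
  smooth_upto n f -> smooth_upto n g -> smooth_upto n (fun x => f x * g x).
Proof.
elim: n f g => [//|n IH] f g fS gS.
have sf := smooth_uptoS fS; have sg := smooth_uptoS gS.
move: fS gS => [f' df sf'] [g' dg sg'].
exists (fun x => f x * g' x + g x * f' x).
  by move=> x; exact: (@is_deriveM _ _ f g x 1 _ _ (df x) (dg x)).
by apply: smooth_uptoD; exact: IH.
Qed.

Lemma smooth_upto_affine n f (a b : R) :
  smooth_upto n f -> smooth_upto n (fun x => f (a * x + b)).
Proof.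
elim: n f => [//|n IH] f [f' df sf].
exists (fun x => f' (a * x + b) * a).
  move=> x; apply: is_derive1_comp (df _).
  have := @is_deriveD _ _ _ (a \*: (id : R -> R)) (cst b) x 1 _ _ 
    (@is_deriveZ _ _ _ id a x 1 1 (is_derive_id x 1)) (is_derive_cst b x 1).
  by rewrite addr0 [a *: 1]mulr1.
by apply: smooth_uptoM; [exact: IH|exact: smooth_upto_cst].
Qed.

Lemma is_derive_inv (x : R) : x != 0 ->
  is_derive x 1 (fun z : R => z^-1) (- x ^- 2).
Proof.
move=> x0; split; first by apply: derivableV; [|exact: derivable_id].
by rewrite deriveV // ?derive_id ?[_ *: 1]mulr1 //; exact: derivable_id.
Qed.

(* The span of these functions is closed under differentiation. *)
Definition exp_inv (k : nat) (x : R) : R :=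
  if 0 < x then x^-1 ^+ k * expR (- x^-1) else 0.

Lemma is_derive_exp_inv_gt0 k (x : R) : 0 < x ->
  is_derive x 1 (exp_inv k) (exp_inv k.+2 x - k%:R * exp_inv k.+1 x).
Proof.
move=> x0; have nE : \forall z \near x,
    z^-1 ^+ k * expR (- z^-1) = exp_inv k z.
  near=> z; rewrite /exp_inv ifT //; near: z.
  exact: lt_nbhsr.
rewrite /exp_inv x0.
have dV := is_derive_inv (lt0r_neq0 x0).
have dX : is_derive x 1 (fun z : R => z^-1 ^+ k)
    (k%:R * x^-1 ^+ k.-1 * - x ^- 2).
  have -> : (fun z : R => z^-1 ^+ k) = (fun z : R => z^-1) ^+ k.
    by apply/funext => z; rewrite exprfctE.
  exact: is_deriveX.
have dE : is_derive x 1 (fun z : R => expR (- z^-1)) (expR (- x^-1) * (x ^- 2)).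
  apply: is_derive1_comp (is_derive_expR _).
  by have := @is_deriveN _ _ _ _ x 1 _ dV; rewrite opprK.
have := @is_deriveM _ _ _ _ x 1 _ _ dX dE.
set D1 := _ + _; set D2 := (X in _ -> is_derive _ _ _ X).
suff -> : D1 = D2 by apply: near_eq_is_derive; exact: nE.
rewrite /D1 /D2 /GRing.scale /= -exprVn; case: k {nE dX D1 D2} => [|k] /=.
  by rewrite !expr0 mul0r !mul0r !mulr0 addr0 subr0 mul1r mulrC.
rewrite !exprS; ring.
Unshelve. all: by end_near. Qed.

(** One term of the exponential series, [y ^ (k + 2) / (k + 2)! <= exp y] at [y = 1 / x]. The
    exponent 2 left over yields a zero derivative at the origin. *)
Lemma exp_inv_le_sqr k (x : R) : `|exp_inv k x| <= (k.+2)`!%:R * x ^+ 2.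
Proof.
rewrite /exp_inv; case: ifPn => x0; last by rewrite normr0 mulr_ge0 ?sqr_ge0.
have y0 : 0 < x^-1 by rewrite invr_gt0.
rewrite ger0_norm; last by rewrite mulr_ge0 ?expR_ge0 // exprn_ge0 // ltW.
rewrite expRN ler_pdivrMr ?expR_gt0 //.
have := @expR_ge1Dxn _ (x^-1) k.+1 (ltW y0).
set e := expR _ => H.
have {}H : x^-1 ^+ k.+2 <= (k.+2)`!%:R * e.
  rewrite mulrC -ler_pdivrMr ?ltr0n ?fact_gt0 //.
  by apply: le_trans H; rewrite lerDr.
rewrite mulrAC -ler_pdivrMr ?exprn_gt0 //; apply: le_trans H.
by rewrite -exprVn -exprD addn2.
Qed.

Lemma is_derive_exp_inv k (x : R) :
  is_derive x 1 (exp_inv k) (exp_inv k.+2 x - k%:R * exp_inv k.+1 x).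
Proof.
have [x0|x0] := ltP 0 x; first exact: is_derive_exp_inv_gt0.
have E0 j : exp_inv j x = 0 by rewrite /exp_inv ltNge x0.
rewrite !E0 mulr0 subr0.
move: x0; rewrite le_eqVlt => /predU1P[x0|x0]; last first.
  apply: near_eq_is_derive (is_derive_cst (0 : R) x 1).
  near=> z; rewrite /exp_inv ifN // -leNgt ltW //; near: z.
  exact: lt_nbhsl.
(* Only [x = 0] is left, where the quadratic bound makes the difference quotient at most
   [(k + 2)! |h|]. *)
have L : (fun h : R => h^-1 *: ((exp_inv k \o shift x) (h *: 1) - exp_inv k x))
    @ 0^' --> (0 : R).
  apply/cvgr0Pnorm_le => e e0.
  have C0 : 0 < (k.+2)`!%:R :> R by rewrite ltr0n fact_gt0.
  near=> h; have h0 : h != 0 by near: h; exact: nbhs_dnbhs_neq.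
  rewrite /= E0 subr0 x0 addr0 [h *: 1]mulr1 normrZ normfV.
  rewrite ler_pdivrMl ?normr_gt0 //; apply: le_trans (exp_inv_le_sqr _ _) _.
  rewrite -[h ^+ 2](real_normK (num_real h)) expr2 mulrA [leLHS]mulrC.
  rewrite ler_wpM2l // mulrC -ler_pdivlMr //.
  by near: h; apply: dnbhs0_le; rewrite divr_gt0.
by split; [apply/cvg_ex; exists 0|exact/cvg_lim].
Unshelve. all: by end_near. Qed.

Lemma smooth_exp_inv k : smooth (exp_inv k).
Proof.
move=> n; elim: n k => [//|n IH] k.
exists (fun x => exp_inv k.+2 x + - k%:R * exp_inv k.+1 x).
  by move=> x; rewrite mulNr; exact: is_derive_exp_inv.
apply: smooth_uptoD; first exact: IH.
by apply: smooth_uptoM; [exact: smooth_upto_cst|exact: IH].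
Qed.

Lemma exp_inv_ge0 k x : 0 <= exp_inv k x.
Proof.
rewrite /exp_inv; case: ifP => // x0.
by rewrite mulr_ge0 ?expR_ge0 ?exprn_ge0 // invr_ge0 ltW.
Qed.

Lemma exp_inv0_le1 x : exp_inv 0 x <= 1.
Proof.
rewrite /exp_inv; case: ifP => // x0.
by rewrite expr0 mul1r expR_le1 oppr_le0 invr_ge0 ltW.
Qed.

Lemma exp_inv0_cvg (x : R) : 0 < x ->
  exp_inv 0 (n.+1%:R * x) @[n --> \oo] --> (1 : R).
Proof.
move=> x0.
have -> : (fun n : nat => exp_inv 0 (n.+1%:R * x)) =
    (fun n : nat => expR (- (n.+1%:R^-1 * x^-1))).
  apply/funext => n; rewrite /exp_inv ifT; last by rewrite mulr_gt0.
  by rewrite expr0 mul1r invfM.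
rewrite -[X in _ --> X](@expR0 R) -oppr0 -(mul0r (x^-1)).
apply: (@continuous_cvg _ _ _ _ _ _ (expR : R -> R)); first exact: continuous_expR.
by apply: cvgN; apply: cvgM; [exact: cvg_harmonic|exact: cvg_cst].
Qed.

(** A smooth approximation of the indicator of []s, t[]: each factor lies in [[0, 1]], vanishes
    beyond its end point and tends to 1 inside as [n] grows. No normalization is made. *)
Definition bump (n : nat) (s t x : R) : R :=
  exp_inv 0 (n.+1%:R * (x - s)) * exp_inv 0 (n.+1%:R * (t - x)).

Lemma smooth_bump n s t : smooth (bump n s t).
Proof.
move=> m; rewrite /bump; apply: smooth_uptoM.
  have := smooth_upto_affine n.+1%:R (- (n.+1%:R * s)) (@smooth_exp_inv 0 m).
  by under eq_fun do rewrite -mulrBr.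
have := smooth_upto_affine (- n.+1%:R) (n.+1%:R * t) (@smooth_exp_inv 0 m).
by under eq_fun do rewrite mulNr addrC -mulrBr.
Qed.

Lemma bump_ge0 n s t x : 0 <= bump n s t x.
Proof. by rewrite mulr_ge0 // exp_inv_ge0. Qed.

Lemma bump_le1 n s t x : bump n s t x <= 1.
Proof. by rewrite mulr_ile1 // ?exp_inv_ge0 // exp_inv0_le1. Qed.

Lemma bump_out n s t x : x \notin `]s, t[ -> bump n s t x = 0.
Proof.
rewrite in_itv /= negb_and -!leNgt /bump /exp_inv => /orP[xs|xt].
  by rewrite ifN ?mul0r // -leNgt pmulr_rle0 // subr_le0.
by rewrite [X in _ * X]ifN ?mulr0 // -leNgt pmulr_rle0 // subr_le0.
Qed.

Lemma bump_outS n s t a b x : a <= s -> t <= b -> x \notin `]a, b[ ->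
  bump n s t x = 0.
Proof.
move=> as_ tb xab; apply: bump_out; apply: contra xab.
rewrite !in_itv /= => /andP[sx xt].
by rewrite (le_lt_trans as_ sx) (lt_le_trans xt tb).
Qed.

Lemma bump_cvg s t x : bump n s t x @[n --> \oo] --> (\1_`]s, t[ x : R).
Proof.
rewrite indicE; have [|xst] := boolP (x \in `]s, t[).
  rewrite in_itv => /= /andP[sx xt].
  rewrite mem_set; last by rewrite /= in_itv /= sx xt.
  rewrite (_ : true%:R = 1 * 1 :> R); last by rewrite mulr1.
  by apply: cvgM; apply: exp_inv0_cvg; rewrite subr_gt0.
rewrite memNset; last exact/negP.
have -> : (fun n => bump n s t x) = (fun=> 0).
  by apply/funext => n; rewrite bump_out.
exact: cvg_cst.
Qed.

End SmoothFunctions.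

(** * The fundamental lemma in one dimension *)

Section AlmostEverywhere.
Context d (T : measurableType d) (R : realType).
Variable nu : {measure set T -> \bar R}.
Implicit Types P Q S : T -> Prop.

Lemma ae_sub P Q : (forall x, P x -> Q x) ->
  {ae nu, forall x, P x} -> {ae nu, forall x, Q x}.
Proof. by move=> PQ; apply: filterS. Qed.

Lemma ae_and P Q : {ae nu, forall x, P x} -> {ae nu, forall x, Q x} ->
  {ae nu, forall x, P x /\ Q x}.
Proof. by apply: filterS2 => x. Qed.

End AlmostEverywhere.

Section FundamentalLemma.
Context {R : realType}.
Notation mu := (@lebesgue_measure R).
Implicit Types (f g : R -> R).

Lemma integrable_mul_bounded d (T : measurableType d)
    (nu : {measure set T -> \bar R}) (f h : T -> R) (C : R) :
  nu.-integrable setT (EFin \o f) -> measurable_fun setT h ->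
  (forall x, `|h x| <= C) ->
  nu.-integrable setT (EFin \o (fun x => f x * h x)).
Proof.
move=> intf mh hC.
have mf : measurable_fun setT f.
  by apply/measurable_EFinP; exact: measurable_int intf.
apply: (@le_integrable _ _ _ nu setT measurableT _ (fun x => C%:E * (EFin \o f) x)%E).
- by apply/measurable_EFinP; exact: measurable_funM.
- move=> x _ /=; rewrite lee_fin normrM mulrC normrM.
  by rewrite ler_wpM2r //; apply: le_trans (hC x) (ler_norm _).
- exact: integrableZl.
Qed.

Lemma smooth_continuous f : smooth f -> continuous f.
Proof.
move=> /(_ 1%N) [f' df _] x.
by apply/differentiable_continuous/derivable1_diffP; have [] := df x.
Qed.

Lemma smooth_measurable f : smooth f -> measurable_fun setT f.
Proof. by move=> sf; apply: continuous_measurable_fun; exact: smooth_continuous. Qed.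

(** Rationals accumulate at [x]: continuity there gives [f x = c], and the difference quotients
    along rationals then vanish. *)
Lemma derive1_const_rat f (a b x : R) (c : R) : x \in `]a, b[ ->
  derivable f x 1 ->
  (forall q : rat, ratr q \in `]a, b[ -> f (ratr q) = c) -> f^`()%classic x = 0.
Proof.
rewrite in_itv /= => /andP[ax xb] dfx fc.
have cf : {for x, continuous f}.
  by apply/differentiable_continuous/derivable1_diffP.
have rats (e : R) : 0 < e -> exists q : rat,
    [/\ ratr q \in `]a, b[, ratr q != x & `|ratr q - x| < e].
  move=> e0; have : x < Num.min b (x + e) by rewrite lt_min xb ltrDl.
  move/rat_in_itvoo => [q]; rewrite in_itv /= lt_min => /and3P[xq qb qe].
  exists q; split; first by rewrite in_itv /= qb (lt_trans ax xq).
    by rewrite gt_eqF.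
  by rewrite ger0_norm ?subr_ge0 ?ltW // ltrBlDl.
have fx : f x = c.
  apply/eqP; rewrite -subr_eq0 -normr_eq0 eq_le normr_ge0 andbT.
  apply/ler_addgt0Pr => e e0; rewrite add0r.
  have /cvgrPdist_le /(_ _ e0) /nbhs_ballP[r r0 H] := cf.
  have [q [qab _ qx]] := rats _ r0.
  by rewrite -(fc q qab); apply: H; rewrite -ball_normE /= distrC.
apply/eqP; rewrite -normr_eq0 eq_le normr_ge0 andbT.
apply/ler_addgt0Pr => e e0; rewrite add0r.
have /cvg_ex[l fl] := dfx.
have -> : f^`()%classic x = l by rewrite derive1E; apply: cvg_lim.
move/cvgrPdist_le : fl => /(_ _ e0) /nbhs_ballP[r r0 H].
have [q [qab qnx qx]] := rats _ r0.
have := H (ratr q - x); rewrite /= [_ *: 1]mulr1 subrK fc // fx subrr scaler0 subr0.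
by apply; rewrite ?subr_eq0 // -ball_normE /= sub0r normrN.
Qed.

Lemma bump_Rintegral_cvg f (s t : R) : mu.-integrable setT (EFin \o f) ->
  (\int[mu]_x (f x * bump n s t x)) @[n --> \oo] --> \int[mu]_(x in `]s, t[) f x.
Proof.
move=> intf.
have mf : measurable_fun setT f.
  by apply/measurable_EFinP; exact: measurable_int intf.
have mb n : measurable_fun setT (bump n s t).
  exact: smooth_measurable (smooth_bump n s t).
have intb n : mu.-integrable setT (EFin \o (fun x => f x * bump n s t x)).
  apply: (integrable_mul_bounded intf (mb n) (C := 1)) => x.
  by rewrite ger0_norm ?bump_ge0 ?bump_le1.
have mi : measurable_fun setT (\1_(`]s, t[) : R -> R).
  by apply: measurable_indic; exact: measurable_itv.
have [||||i1 _ L] := @dominated_convergence _ _ _ mu setT measurableT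
  (fun n x => (f x * bump n s t x)%:E) (fun x => (f x * \1_(`]s, t[) x)%:E)
  (abse \o (EFin \o f)) (fun n => measurable_int _ (intb n)).
- by apply/measurable_EFinP; exact: measurable_funM.
- apply: aeW => x _; apply: cvg_EFin; first exact: nearW.
  by apply: cvgM; [exact: cvg_cst|exact: bump_cvg].
- exact: integrable_abse.
- apply: aeW => x n _ /=; rewrite lee_fin normrM -[leRHS]mulr1 ler_wpM2l //.
  by rewrite ger0_norm ?bump_ge0 ?bump_le1.
have E : \int[mu]_(x in `]s, t[) f x = \int[mu]_x (f x * \1_(`]s, t[) x).
  rewrite Rintegral_mkcond; congr fine; apply: eq_integral => x _.
  by rewrite patchE indicE; case: ifP; rewrite ?mulr1 ?mulr0.
rewrite E; apply: (@fine_cvg R _ _ _ _ _).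
have -> : (\int[mu]_x (f x * \1_(`]s, t[) x))%:E =
    (\int[mu]_x (f x * \1_(`]s, t[) x)%:E)%E.
  by rewrite fineK //; exact: integrable_fin_num.
exact: L.
Qed.

(** In the limit of the bumps, [f] has integral zero over the rational subintervals, so its
    primitive is constant on the rationals of []a, b[]. By Lebesgue differentiation that primitive
    has derivative [f] almost everywhere, and this derivative is 0. *)
Lemma bump_orthogonal_ae0 f (a b : R) : mu.-integrable setT (EFin \o f) ->
  (forall n (s t : rat), a <= ratr s -> ratr s < ratr t :> R -> ratr t <= b ->
    \int[mu]_x (f x * bump n (ratr s) (ratr t) x) = 0) ->
  {ae mu, forall x, x \in `]a, b[ -> f x = 0}.
Proof.
move=> intf H.
have intS (A : set R) : measurable A -> mu.-integrable A (EFin \o f).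
  by move=> mA; apply: integrableS intf.
have H0 (s t : rat) : a <= ratr s -> ratr s < ratr t :> R -> ratr t <= b ->
    \int[mu]_(x in `]ratr s, ratr t[) f x = 0.
  move=> as_ st tb.
  have L := bump_Rintegral_cvg (s := ratr s) (t := ratr t) intf.
  have E : (fun n => \int[mu]_x (f x * bump n (ratr s) (ratr t) x)) = fun=> 0.
    by apply/funext => n; exact: H.
  by rewrite -(cvg_lim (@Rhausdorff R) L) E lim_cst.
pose F x := \int[mu]_(t in `]-oo, x]) f t.
have F0 (s t : rat) : a <= ratr s -> ratr s < ratr t :> R -> ratr t <= b ->
    F (ratr t) = F (ratr s).
  move=> as_ st tb; apply/eqP; rewrite -subr_eq0; apply/eqP.
  rewrite /F (@Rintegral_itvB _ _ -oo%O (BRight (ratr t)) (ratr s)) //.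
  - rewrite -Rintegral_itv_bndo_bndc ?H0 //.
    by apply: intS; exact: measurable_itv.
  - by apply: intS; exact: measurable_itv.
  - by rewrite bnd_simp ltW.
have := @FTC1Ny R f (fun y => intS _ (measurable_itv _))
  (open_integrable_locally openT intf).
apply: ae_sub => x [dF <-] xab.
have [q qab] : exists q : rat, ratr q \in `]a, b[.
  move: xab; rewrite in_itv /= => /andP[ax xb].
  have /rat_in_itvoo[q qq] := lt_trans ax xb; by exists q.
apply: (derive1_const_rat xab dF (c := F (ratr q))) => r.
move: qab; rewrite !in_itv /= => /andP[aq qb] /andP[ar rb].
case: (ltgtP (ratr r : R) (ratr q)) => [rq|rq|->//].
  by rewrite (F0 r q) ?ltW.
by rewrite -(F0 q r) ?ltW.
Qed.

End FundamentalLemma.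

(** * Fubini for real-valued integrals *)

Section RealIntegrable.
Context d (T : measurableType d) (R : realType).
Variable nu : {measure set T -> \bar R}.
Implicit Types f g : T -> R.

Lemma integrableT_measurable f :
  nu.-integrable setT (EFin \o f) -> measurable_fun setT f.
Proof. by move=> intf; apply/measurable_EFinP; exact: measurable_int intf. Qed.

Lemma integrableRD f g :
  nu.-integrable setT (EFin \o f) -> nu.-integrable setT (EFin \o g) ->
  nu.-integrable setT (EFin \o (fun x => f x + g x)).
Proof. by move=> fi gi; exact: (integrableD measurableT fi gi). Qed.

Lemma integrableRB f g :
  nu.-integrable setT (EFin \o f) -> nu.-integrable setT (EFin \o g) ->
  nu.-integrable setT (EFin \o (fun x => f x - g x)).
Proof. by move=> fi gi; exact: (integrableB measurableT fi gi). Qed.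

Lemma integrableRZl (c : R) f :
  nu.-integrable setT (EFin \o f) ->
  nu.-integrable setT (EFin \o (fun x => c * f x)).
Proof. by move=> fi; exact: (integrableZl measurableT c fi). Qed.

End RealIntegrable.

Section RealFubini.
Context d1 d2 (T1 : measurableType d1) (T2 : measurableType d2) (R : realType).
Variable m1 : {sigma_finite_measure set T1 -> \bar R}.
Variable m2 : {sigma_finite_measure set T2 -> \bar R}.

Lemma normr_fine_le (z : \bar R) : (`|fine z|%:E <= `|z|)%E.
Proof. by case: z => [r||] //=; rewrite ?normr0 ?leey. Qed.

Lemma ae_fineK_integral d (T : measurableType d)
    (m : {measure set T -> \bar R}) (h : T -> \bar R) :
  m.-integrable setT h -> ae_eq m setT (EFin \o (fine \o h)) h.
Proof.
move=> ih; have := integrable_ae measurableT ih.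
apply: filterS => x /= hx xT.
by rewrite fineK //; exact: hx.
Qed.

Lemma integrable_fine d (T : measurableType d)
    (m : {measure set T -> \bar R}) (h : T -> \bar R) :
  m.-integrable setT h -> m.-integrable setT (EFin \o (fine \o h)).
Proof.
move=> ih; apply: (le_integrable measurableT _ _ ih).
  apply/measurable_EFinP; apply: measurableT_comp => //.
  exact: measurable_int ih.
by move=> x _ /=; exact: normr_fine_le.
Qed.

(** [fine] turns infinite values into 0, which for an integrable [h] happens on a null set only.
    Real-valued inner integrals in Fubini's theorem are legitimate for this reason. *)
Lemma Rintegral_fine d (T : measurableType d)
    (m : {measure set T -> \bar R}) (h : T -> \bar R) :
  m.-integrable setT h -> \int[m]_x fine (h x) = fine (\int[m]_x h x)%E.
Proof.
move=> ih; congr fine; apply: ae_eq_integral => //.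
- exact: measurable_int (integrable_fine ih).
- exact: measurable_int ih.
- exact: ae_fineK_integral.
Qed.

Variable f : T1 * T2 -> R.
Hypothesis intf : (m1 \x m2)%E.-integrable setT (EFin \o f).

Lemma integrable_fubini_G : m2.-integrable setT (fubini_G m1 (EFin \o f)).
Proof.
have mf := measurable_int _ intf.
apply/integrableP; split; first exact: (measurable_fubini_G intf).
apply: le_lt_trans ((integrable21ltyP _ _ mf).1 intf).
apply: ge0_le_integral => //.
- by apply: measurableT_comp => //; exact: (measurable_fubini_G intf).
- have mabs : measurable_fun setT (abse \o (EFin \o f)).
    exact: measurableT_comp.
  have abs0 z : (0 <= (abse \o (EFin \o f)) z)%E by exact: abse_ge0.
  by apply: (measurable_fun_fubini_tonelli_G (abse \o (EFin \o f))).
- move=> y _; apply: le_abse_integral => //.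
  exact: (measurableT_comp mf (pair2_measurable y)).
Qed.

Lemma integrable_Rfubini1 :
  m1.-integrable setT (EFin \o (fun x => \int[m2]_y f (x, y))).
Proof. exact: (integrable_fine (integrable_fubini_F intf)). Qed.

Lemma integrable_Rfubini2 :
  m2.-integrable setT (EFin \o (fun y => \int[m1]_x f (x, y))).
Proof. exact: (integrable_fine integrable_fubini_G). Qed.

Lemma Rfubini1 :
  \int[m1]_x \int[m2]_y f (x, y) = \int[(m1 \x m2)%E]_z f z.
Proof.
rewrite (Rintegral_fine (integrable_fubini_F intf)).
by congr fine; exact: integral12_prod_meas1.
Qed.

Lemma Rfubini2 :
  \int[m2]_y \int[m1]_x f (x, y) = \int[(m1 \x m2)%E]_z f z.
Proof.
rewrite (Rintegral_fine integrable_fubini_G).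
by congr fine; exact: integral21_prod_meas1.
Qed.

End RealFubini.

Section Tensor.
Context d1 d2 (T1 : measurableType d1) (T2 : measurableType d2) (R : realType).
Variable m1 : {sigma_finite_measure set T1 -> \bar R}.
Variable m2 : {sigma_finite_measure set T2 -> \bar R}.

Lemma integrable_tensor (g : T1 -> R) (q : T2 -> R) :
  m1.-integrable setT (EFin \o g) -> m2.-integrable setT (EFin \o q) ->
  (m1 \x m2)%E.-integrable setT (EFin \o (fun z : T1 * T2 => g z.1 * q z.2)).
Proof.
move=> ig iq.
have mg : measurable_fun setT g.
  by apply/measurable_EFinP; exact: measurable_int ig.
have mq : measurable_fun setT q.
  by apply/measurable_EFinP; exact: measurable_int iq.
apply/integrable12ltyP.
  apply/measurable_EFinP; apply: measurable_funM.
    exact: (measurableT_comp mg measurable_fst).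
  exact: (measurableT_comp mq measurable_snd).
have [_ q1] := integrableP _ _ _ iq; have [_ g1] := integrableP _ _ _ ig.
set Q := (\int[m2]_y `|(EFin \o q) y|)%E in q1.
have Q0 : (0 <= Q)%E by exact: integral_ge0.
have Qfin : Q \is a fin_num by rewrite ge0_fin_numE.
rewrite (eq_integral (fun x => (fine Q)%:E * `|(EFin \o g) x|)%E).
  rewrite ge0_integralZl_EFin ?fine_ge0 //.
    by rewrite lte_mul_pinfty // lee_fin fine_ge0.
  by apply: measurableT_comp => //; exact/measurable_EFinP.
move=> x _; rewrite fineK // muleC.
rewrite -ge0_integralZl //.
- by apply: eq_integral => y _ /=; rewrite normrM EFinM.
- by apply: measurableT_comp => //; exact/measurable_EFinP.
Qed.

End Tensor.

(** * Weak derivatives in one dimension *)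

Section OneDimension.
Context {R : realType}.
Notation mu := (@lebesgue_measure R).
Implicit Types (f g v q : R -> R).

(** Starting at [-oo] keeps the primitive bounded for every integrable [f]. When [f] has mean zero
    and vanishes off an interval, so does its primitive. *)
Definition primitive f (x : R) : R := \int[mu]_(t in `]-oo, x]) f t.

Lemma bump_integrable n (s t : R) : mu.-integrable setT (EFin \o bump n s t).
Proof.
have -> : bump n s t = (fun x => \1_(`]s, t[) x * bump n s t x).
  apply/funext => x; rewrite indicE; have [|xst] := boolP (x \in `]s, t[).
    by move=> xst; rewrite mem_set // mul1r.
  by rewrite bump_out // mulr0.
apply: (integrable_mul_bounded (C := 1)).
- exact: integrable_indic_itv.
- exact: smooth_measurable (smooth_bump n s t).
- by move=> x; rewrite ger0_norm ?bump_ge0 ?bump_le1.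
Qed.

Lemma primitive_bounded f x : mu.-integrable setT (EFin \o f) ->
  `|primitive f x| <= \int[mu]_t `|f t|.
Proof.
move=> intf.
have intx : mu.-integrable `]-oo, x] (EFin \o f).
  by apply: integrableS intf => //; exact: measurable_itv.
apply: (le_trans (le_normr_Rintegral _ intx)); first exact: measurable_itv.
rewrite Rintegral_mkcond; apply: le_Rintegral => //.
- rewrite -restrict_EFin -integrable_mkcond; last exact: measurable_itv.
  exact: integrable_norm.
- exact: integrable_norm.
- by move=> t _; rewrite patchE; case: ifP => _ //=; exact: normr_ge0.
Qed.

Lemma measurable_le_pair :
  measurable [set z : measurableTypeR R * measurableTypeR R | z.1 <= z.2].
Proof.
have -> : [set z : measurableTypeR R * measurableTypeR R | z.1 <= z.2] =
    setT `&` (fun z => z.2 - z.1) @^-1` `[0, +oo[.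
  apply/seteqP; split => z /=; rewrite in_itv /= andbT subr_ge0 //.
  by case.
have m : measurable_fun setT
    (fun z : measurableTypeR R * measurableTypeR R => z.2 - z.1).
  by apply: measurable_funB; [exact: measurable_snd|exact: measurable_fst].
by apply: m => //; exact: measurable_itv.
Qed.

Lemma Rintegral_le_itv f (x : R) :
  \int[mu]_t (f t * \1_[set z : R * R | z.1 <= z.2] (t, x)) = primitive f x.
Proof.
rewrite /primitive [RHS]Rintegral_mkcond; congr fine; apply: eq_integral => t _.
rewrite patchE indicE; have [tx|tx] := boolP (t <= x).
  by rewrite !mem_set /= ?in_itv //= mulr1.
by rewrite !memNset ?mulr0 //= ?in_itv /= ; exact/negP.
Qed.

Lemma Rintegral_ge_itv f (t : R) : mu.-integrable setT (EFin \o f) ->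
  \int[mu]_x (f x * \1_[set z : R * R | z.1 <= z.2] (t, x)) =
  \int[mu]_x f x - primitive f t.
Proof.
move=> intf.
have intS (A : set R) : measurable A -> mu.-integrable A (EFin \o f).
  by move=> mA; apply: integrableS intf.
have := @Rintegral_itvB _ f -oo%O +oo%O t; rewrite set_itvE => /(_ intf erefl erefl).
rewrite /primitive => ->.
rewrite Rintegral_itv_obnd_cbnd; last by apply: intS; exact: measurable_itv.
rewrite [RHS]Rintegral_mkcond; congr fine; apply: eq_integral => x _.
rewrite patchE indicE; have [tx|tx] := boolP (t <= x).
  by rewrite !mem_set /= ?in_itv /= ?tx ?mulr1.
by rewrite !memNset ?mulr0 //= ?in_itv /= ?andbT; exact/negP.
Qed.

(** The indicator of [t <= x] turns the moving domain into a fixed one; Tonelli's theorem for the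
    positive and negative parts then gives measurability in [x]. *)
Lemma measurable_primitive g : mu.-integrable setT (EFin \o g) ->
  measurable_fun setT (primitive g).
Proof.
move=> /integrableT_measurable mg.
pose h : measurableTypeR R * measurableTypeR R -> \bar R :=
  fun z => (g z.1 * \1_[set z : R * R | z.1 <= z.2] z)%:E.
have mh : measurable_fun setT h.
  apply/measurable_EFinP; apply: measurable_funM.
    exact: (measurableT_comp mg measurable_fst).
  by apply: measurable_indic; exact: measurable_le_pair.
have -> : primitive g = fine \o
    (fun x => \int[mu]_t h^\+ (t, x) - \int[mu]_t h^\- (t, x))%E.
  apply/funext => x; rewrite -Rintegral_le_itv /Rintegral integralE /=.
  by congr (fine (_ - _)%E); apply: eq_integral => t _; rewrite unlock.
have mp := @measurable_fun_fubini_tonelli_G _ _ _ _ R mu (h^\+)%E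
  (measurable_funepos mh) (funepos_ge0 h).
have mn := @measurable_fun_fubini_tonelli_G _ _ _ _ R mu (h^\-)%E
  (measurable_funeneg mh) (funeneg_ge0 h).
have mB := emeasurable_funB mp mn.
by apply: (measurableT_comp _ mB).
Qed.

(** Both sides are iterated integrals of [g t * q x] over [t <= x]. Integrating in [x] gives the
    integral of [q] over [[t, +oo[], which is [- primitive q t] because [q] has mean zero. *)
Lemma primitive_by_parts g q :
  mu.-integrable setT (EFin \o g) -> mu.-integrable setT (EFin \o q) ->
  \int[mu]_x q x = 0 ->
  \int[mu]_x (primitive g x * q x) = - \int[mu]_x (g x * primitive q x).
Proof.
move=> ig iq q0.
pose k : R * R -> R := \1_[set z : R * R | z.1 <= z.2].
have mk : measurable_fun setT (k : measurableTypeR R * measurableTypeR R -> R).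
  by apply: measurable_indic; exact: measurable_le_pair.
have k1 z : `|k z| <= 1.
  by rewrite /k indicE; case: (_ \in _); rewrite ?normr0 ?normr1.
have ih := integrable_mul_bounded (C := 1) (integrable_tensor ig iq) mk k1.
have mk1 x : measurable_fun setT (fun t : measurableTypeR R => k (t, x)).
  exact: (measurable_fun_pair1 x mk).
have mk2 t : measurable_fun setT (fun x : measurableTypeR R => k (t, x)).
  exact: (measurable_fun_pair2 t mk).
have F2 : \int[mu]_x (primitive g x * q x) =
    \int[mu]_x \int[mu]_t (g t * q x * k (t, x)).
  congr fine; apply: eq_integral => x _; congr EFin.
  rewrite -Rintegral_le_itv -RintegralZr //.
    by congr fine; apply: eq_integral => t _; rewrite mulrAC.
  exact: (integrable_mul_bounded ig (mk1 x) (fun t => k1 (t, x))).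
have F1 : - (\int[mu]_x (g x * primitive q x)) =
    \int[mu]_t \int[mu]_x (g t * q x * k (t, x)).
  have igA := integrable_mul_bounded ig (measurable_primitive iq)
    (fun x => primitive_bounded x iq).
  rewrite -[LHS]mulN1r -(RintegralZl _ measurableT igA).
  congr fine; apply: eq_integral => t _; congr EFin.
  have qt : \int[mu]_x (q x * k (t, x)) = - primitive q t.
    by rewrite Rintegral_ge_itv // q0 sub0r.
  rewrite mulN1r -mulrN -qt -RintegralZl //.
    by congr fine; apply: eq_integral => x _; rewrite mulrA.
  exact: (integrable_mul_bounded iq (mk2 t) (fun x => k1 (t, x))).
by rewrite F1 F2 (Rfubini1 ih) (Rfubini2 ih).
Qed.


(** Here [x], [y] are the integrals of [v] against the bump and against [th], [u], [w] those of
    [primitive g], [c] is the integral of the bump, [z] the integral of [g * primitive q], and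
    [y - w] is the constant [k]. *)
Lemma cancel_mean (x y z u w c : R) :
  x - c * y + z = 0 -> u - c * w = - z -> x - (u + (y - w) * c) = 0.
Proof. by move=> h1 h2; lra. Qed.

(* Subtracting a multiple of [th] makes a bump mean zero, so that it is the
   derivative of a compactly supported function; this determines [v - G] up
   to the constant [k], its mean against [th]. *)
Lemma weak_derivative_primitive (v g th : R -> R) (a b C : R) :
  mu.-integrable setT (EFin \o v) -> mu.-integrable setT (EFin \o g) ->
  mu.-integrable setT (EFin \o th) -> (forall x, `|th x| <= C) ->
  \int[mu]_x th x = 1 ->
  (forall n (s t : rat), a <= ratr s -> ratr s < ratr t :> R -> ratr t <= b ->
    let p := bump n (ratr s) (ratr t) in
    let q := fun x => p x - (\int[mu]_y p y) * th x in
    \int[mu]_x (v x * q x + g x * primitive q x) = 0) ->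
  exists k, {ae mu, forall x, x \in `]a, b[ -> v x = k + primitive g x}.
Proof.
move=> iv ig ith thC th1 H.
have mth := integrableT_measurable ith.
have mG := measurable_primitive ig.
have GM x := primitive_bounded x ig; set M := \int[mu]_t _ in GM.
have ivth := integrable_mul_bounded iv mth thC.
have iGth (q : R -> R) : mu.-integrable setT (EFin \o q) ->
    mu.-integrable setT (EFin \o (fun x => primitive g x * q x)).
  move=> iq; under eq_fun do rewrite mulrC.
  exact: integrable_mul_bounded iq mG GM.
pose k := \int[mu]_x (v x * th x) - \int[mu]_x (primitive g x * th x).
exists k.
pose ab : R -> R := \1_(`]a, b[).
(* A constant is not integrable on the line, so the difference is cut off to []a, b[], outside of
   which the admissible bumps vanish. *)
pose f x := (v x - primitive g x - k) * ab x.
have mI : measurable_fun setT ab.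
  by apply: measurable_indic; exact: measurable_itv.
have iI : mu.-integrable setT (EFin \o ab).
  exact: integrable_indic_itv.
have I1 x : `|ab x| <= 1.
  by rewrite /ab indicE; case: (_ \in _); rewrite ?normr0 ?normr1.
have intf : mu.-integrable setT (EFin \o f).
  have -> : f = (fun x => v x * ab x - (primitive g x * ab x + k * ab x)).
    by apply/funext => x; rewrite /f; ring.
  apply: integrableRB; first exact: integrable_mul_bounded iv mI I1.
  by apply: integrableRD; [exact: iGth|exact: integrableRZl].
suff : {ae mu, forall x, x \in `]a, b[ -> f x = 0}.
  apply: ae_sub => x fx xab; have := fx xab.
  by rewrite /f /ab indicE mem_set // mulr1; lra.
apply: (bump_orthogonal_ae0 intf) => n s t as_ st tb.
pose p := bump n (ratr s : R) (ratr t); pose c := \int[mu]_y p y.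
pose q x := p x - c * th x.
have {}H : \int[mu]_x (v x * q x + g x * primitive q x) = 0 := H n s t as_ st tb.
rewrite -/p.
have ip : mu.-integrable setT (EFin \o p) by exact: bump_integrable.
have mp := integrableT_measurable ip.
have p1 x : `|p x| <= 1 by rewrite ger0_norm ?bump_ge0 ?bump_le1.
have iq : mu.-integrable setT (EFin \o q).
  exact: (integrableRB ip (integrableRZl c ith)).
have q0 : \int[mu]_x q x = 0.
  rewrite /q RintegralB //; first by rewrite RintegralZl // th1 mulr1 subrr.
  exact: integrableRZl.
have ivp := integrable_mul_bounded iv mp p1.
have mulq (h : R -> R) : mu.-integrable setT (EFin \o (fun x => h x * p x)) ->
    mu.-integrable setT (EFin \o (fun x => h x * th x)) ->
    \int[mu]_x (h x * q x) = \int[mu]_x (h x * p x) - c * \int[mu]_x (h x * th x)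
    /\ mu.-integrable setT (EFin \o (fun x => h x * q x)).
  move=> ihp ihth.
  have ic : mu.-integrable setT (EFin \o (fun x => c * (h x * th x))).
    exact: integrableRZl.
  have E : (fun x => h x * q x) = (fun x => h x * p x - c * (h x * th x)).
    by apply/funext => x; rewrite /q; ring.
  rewrite E; split; first by rewrite RintegralB // RintegralZl.
  exact: integrableRB.
have [Ev ivq] := mulq v ivp ivth.
have [EG iGq] := mulq (primitive g) (iGth p ip) (iGth th ith).
have igA : mu.-integrable setT (EFin \o (fun x => g x * primitive q x)).
  exact: (integrable_mul_bounded ig (measurable_primitive iq)
    (fun x => primitive_bounded x iq)).
rewrite RintegralD // Ev in H.
have E : (fun x => f x * p x) = (fun x => v x * p x - (primitive g x * p x + k * p x)).
  apply/funext => x; rewrite /f /ab indicE; have [xab|xab] := boolP (x \in `]a, b[).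
    by rewrite mem_set // mulr1; ring.
  have -> : p x = 0 by exact: bump_outS as_ tb xab.
  by rewrite !mulr0 addr0 subr0.
have ikp : mu.-integrable setT (EFin \o (fun x => k * p x)).
  exact: integrableRZl.
have iGp := iGth p ip.
have iS : mu.-integrable setT (EFin \o (fun x => primitive g x * p x + k * p x)).
  exact: integrableRD.
rewrite E RintegralB // RintegralD // RintegralZl // -/c.
have := primitive_by_parts ig iq q0; rewrite EG.
exact: (cancel_mean H).
Qed.

End OneDimension.

(** * Tensor products as test functions *)

Section TestFunctions.
Context {R : realType}.
Notation mu := (@lebesgue_measure R).
Implicit Types (f : R -> R) (z : R * R).

Lemma smoothD f g : smooth f -> smooth g -> smooth (fun x => f x + g x).
Proof. by move=> sf sg n; apply: smooth_uptoD. Qed.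

Lemma smoothM f g : smooth f -> smooth g -> smooth (fun x => f x * g x).
Proof. by move=> sf sg n; apply: smooth_uptoM. Qed.

Lemma smooth_cst (c : R) : smooth (fun=> c).
Proof. by move=> n; exact: smooth_upto_cst. Qed.

Lemma smooth_antiderivative f g :
  (forall x : R, is_derive x 1 f (g x)) -> smooth g -> smooth f.
Proof. by move=> df sg [//|n]; exists g. Qed.

Lemma is_derive_tensor1 (a : R -> R) (da : R) (b : R -> R) z :
  is_derive z.1 1 a da ->
  is_derive z (1, 0) (fun z => a z.1 * b z.2) (da * b z.2).
Proof.
move=> [ad <-].
have E : (fun h : R => h^-1 *: (((fun z => a z.1 * b z.2) \o shift z)
    (h *: (1, 0)) - a z.1 * b z.2)) =
  (fun h => h^-1 *: ((a \o shift z.1) (h *: 1) - a z.1) * b z.2).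
  apply/funext => h /=; rewrite scaler0 add0r -mulrBl.
  by rewrite [LHS]mulrA.
have L : (fun h : R => h^-1 *: (((fun z => a z.1 * b z.2) \o shift z)
    (h *: (1, 0)) - a z.1 * b z.2)) @ 0^' --> 'D_1 a z.1 * b z.2.
  by rewrite E; apply: cvgM; [exact: ad|exact: cvg_cst].
by split; [apply/cvg_ex; eexists; exact: L|exact/cvg_lim].
Qed.

Lemma is_derive_tensor2 (a : R -> R) (db : R) (b : R -> R) z :
  is_derive z.2 1 b db ->
  is_derive z (0, 1) (fun z => a z.1 * b z.2) (a z.1 * db).
Proof.
move=> [bd <-].
have E : (fun h : R => h^-1 *: (((fun z => a z.1 * b z.2) \o shift z)
    (h *: (0, 1)) - a z.1 * b z.2)) =
  (fun h => a z.1 * (h^-1 *: ((b \o shift z.2) (h *: 1) - b z.2))).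
  apply/funext => h /=; rewrite scaler0 add0r -mulrBr.
  by rewrite [LHS]mulrCA.
have L : (fun h : R => h^-1 *: (((fun z => a z.1 * b z.2) \o shift z)
    (h *: (0, 1)) - a z.1 * b z.2)) @ 0^' --> a z.1 * 'D_1 b z.2.
  by rewrite E; apply: cvgM; [exact: cvg_cst|exact: bd].
by split; [apply/cvg_ex; eexists; exact: L|exact/cvg_lim].
Qed.

Lemma smooth_upto1_continuous n f : smooth_upto n.+1 f -> continuous f.
Proof.
move=> [f' df _] x.
by apply/differentiable_continuous/derivable1_diffP; have [] := df x.
Qed.

(** The shift in the index comes from the base cases: level 0 of [class_C] is continuity, which
    [smooth_upto] provides from level 1 on. *)
Lemma class_C_tensor n (a b : R -> R) : smooth_upto n.+1 a -> smooth_upto n.+1 b ->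
  class_C n (fun z => a z.1 * b z.2).
Proof.
elim: n a b => [|n IH] a b sa sb.
  move=> z /=; apply: cvgM.
    apply: (@continuous_cvg _ _ _ _ _ _ a).
      exact: (smooth_upto1_continuous sa).
    exact: cvg_fst.
  apply: (@continuous_cvg _ _ _ _ _ _ b).
    exact: (smooth_upto1_continuous sb).
  exact: cvg_snd.
have [sa' sb'] := (smooth_uptoS sa, smooth_uptoS sb).
move: sa sb => [a' da sa1] [b' db sb1].
have d1 z := @is_derive_tensor1 a (a' z.1) b z (da z.1).
have d2 z := @is_derive_tensor2 a (b' z.2) b z (db z.2).
split; first by move=> z; split; [have [] := d1 z|have [] := d2 z].
  have -> : 'D_(1, 0) (fun z => a z.1 * b z.2) = (fun z => a' z.1 * b z.2).
    by apply/funext => z; have [] := d1 z.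
  exact: IH.
have -> : 'D_(0, 1) (fun z => a z.1 * b z.2) = (fun z => a z.1 * b' z.2).
  by apply/funext => z; have [] := d2 z.
exact: IH.
Qed.


Definition rectangle (a0 b0 c0 d0 : R) : set (R * R) :=
  `[a0, b0] `*` `[c0, d0].

Lemma compact_rectangle a0 b0 c0 d0 : compact (rectangle a0 b0 c0 d0).
Proof. by apply: compact_setX; exact: segment_compact. Qed.

Lemma measurable_rectangle a0 b0 c0 d0 :
  measurable (rectangle a0 b0 c0 d0 : set (measurableTypeR R * measurableTypeR R)).
Proof. by apply: measurableX; exact: measurable_itv. Qed.

(** The closed rectangle contains the set where the product is nonzero, hence its closure, which is
    then compact and inside [Omega]. *)
Lemma test_function_tensor (Omega : set (R * R)) (a b : R -> R)
    (a0 b0 c0 d0 : R) :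
  rectangle a0 b0 c0 d0 `<=` Omega -> smooth a -> smooth b ->
  (forall x, x \notin `]a0, b0[ -> a x = 0) ->
  (forall y, y \notin `]c0, d0[ -> b y = 0) ->
  test_function Omega (fun z => a z.1 * b z.2).
Proof.
move=> KO sa sb za zb.
have cK : closed (rectangle a0 b0 c0 d0).
  by apply: compact_closed; [exact: norm_hausdorff|exact: compact_rectangle].
have sub : closure [set z | a z.1 * b z.2 != 0] `<=` rectangle a0 b0 c0 d0.
  rewrite ((closure_id _).1 cK); apply: closure_subset => z /=.
  rewrite mulf_eq0 negb_or => /andP[az bz]; split => /=; apply: subset_itv_oo_cc.
    by apply/negPn/negP => /za; exact/eqP.
  by apply/negPn/negP => /zb; exact/eqP.
split.
- by move=> n; exact: class_C_tensor.
- have cc := @closed_closure _ [set z : R * R | a z.1 * b z.2 != 0].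
  exact: (subclosed_compact cc (@compact_rectangle a0 b0 c0 d0) sub).
- exact: subset_trans sub KO.
Qed.

(** The test function and its derivative vanish off the rectangle, so [v] and [g] may be replaced by
    0 there. The integrals then extend over the whole plane, ready for Fubini's theorem. *)
Lemma weak_derivative_tensor1 (Omega : set (R * R)) (v g : R * R -> R)
    (a q b : R -> R) (a0 b0 c0 d0 : R) :
  weak_derivative Omega (1, 0) v g -> rectangle a0 b0 c0 d0 `<=` Omega ->
  smooth a -> (forall x : R, is_derive x 1 a (q x)) -> smooth b ->
  (forall x, x \notin `]a0, b0[ -> a x = 0) ->
  (forall x, x \notin `]a0, b0[ -> q x = 0) ->
  (forall y, y \notin `]c0, d0[ -> b y = 0) ->
  \int[leb2 R]_z ((v \_ (rectangle a0 b0 c0 d0)) z * (q z.1 * b z.2)) =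
  - \int[leb2 R]_z ((g \_ (rectangle a0 b0 c0 d0)) z * (a z.1 * b z.2)).
Proof.
move=> wv KO sa da sb za zq zb.
have := wv _ (test_function_tensor KO sa sb za zb).
have zK (f : R -> R) z : (forall x, x \notin `]a0, b0[ -> f x = 0) ->
    z \notin rectangle a0 b0 c0 d0 -> f z.1 * b z.2 = 0.
  move=> zf zK; have [z1|/zf->] := boolP (z.1 \in `]a0, b0[); last by rewrite mul0r.
  have [z2|/zb->] := boolP (z.2 \in `]c0, d0[); last by rewrite mulr0.
  by case/negP: zK; rewrite inE; split; exact: subset_itv_oo_cc.
have D z : 'D_(1, 0) (fun z => a z.1 * b z.2) z = q z.1 * b z.2.
  by have [] := @is_derive_tensor1 a (q z.1) b z (da z.1).
rewrite [LHS]Rintegral_mkcond [X in _ = - X -> _]Rintegral_mkcond => E.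
have E1 : \int[leb2 R]_z ((v \_ (rectangle a0 b0 c0 d0)) z * (q z.1 * b z.2)) =
    \int[leb2 R]_z ((fun z => v z * 'D_(1, 0) (fun z => a z.1 * b z.2) z) \_ Omega) z.
  congr fine; apply: eq_integral => z _; rewrite !patchE D.
  case: ifPn => zr; last first.
    by rewrite zK // !mulr0; case: ifP.
  by rewrite mem_set //; apply: KO; exact: set_mem.
have E2 : \int[leb2 R]_z ((g \_ (rectangle a0 b0 c0 d0)) z * (a z.1 * b z.2)) =
    \int[leb2 R]_z ((fun z => g z * (a z.1 * b z.2)) \_ Omega) z.
  congr fine; apply: eq_integral => z _; rewrite !patchE.
  case: ifPn => zr; last first.
    by rewrite zK // !mulr0; case: ifP.
  by rewrite mem_set //; apply: KO; exact: set_mem.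
by rewrite E1 E2.
Qed.

Lemma weak_derivative_tensor2 (Omega : set (R * R)) (v g : R * R -> R)
    (a b q : R -> R) (a0 b0 c0 d0 : R) :
  weak_derivative Omega (0, 1) v g -> rectangle a0 b0 c0 d0 `<=` Omega ->
  smooth a -> smooth b -> (forall x : R, is_derive x 1 b (q x)) ->
  (forall x, x \notin `]a0, b0[ -> a x = 0) ->
  (forall y, y \notin `]c0, d0[ -> b y = 0) ->
  (forall y, y \notin `]c0, d0[ -> q y = 0) ->
  \int[leb2 R]_z ((v \_ (rectangle a0 b0 c0 d0)) z * (a z.1 * q z.2)) =
  - \int[leb2 R]_z ((g \_ (rectangle a0 b0 c0 d0)) z * (a z.1 * b z.2)).
Proof.
move=> wv KO sa sb db za zb zq.
have := wv _ (test_function_tensor KO sa sb za zb).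
have zK (f : R -> R) z : (forall x, x \notin `]c0, d0[ -> f x = 0) ->
    z \notin rectangle a0 b0 c0 d0 -> a z.1 * f z.2 = 0.
  move=> zf zK; have [z1|/za->] := boolP (z.1 \in `]a0, b0[); last by rewrite mul0r.
  have [z2|/zf->] := boolP (z.2 \in `]c0, d0[); last by rewrite mulr0.
  by case/negP: zK; rewrite inE; split; exact: subset_itv_oo_cc.
have D z : 'D_(0, 1) (fun z => a z.1 * b z.2) z = a z.1 * q z.2.
  by have [] := @is_derive_tensor2 a (q z.2) b z (db z.2).
rewrite [LHS]Rintegral_mkcond [X in _ = - X -> _]Rintegral_mkcond => E.
have E1 : \int[leb2 R]_z ((v \_ (rectangle a0 b0 c0 d0)) z * (a z.1 * q z.2)) =
    \int[leb2 R]_z ((fun z => v z * 'D_(0, 1) (fun z => a z.1 * b z.2) z) \_ Omega) z.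
  congr fine; apply: eq_integral => z _; rewrite !patchE D.
  case: ifPn => zr; last first.
    by rewrite zK // !mulr0; case: ifP.
  by rewrite mem_set //; apply: KO; exact: set_mem.
have E2 : \int[leb2 R]_z ((g \_ (rectangle a0 b0 c0 d0)) z * (a z.1 * b z.2)) =
    \int[leb2 R]_z ((fun z => g z * (a z.1 * b z.2)) \_ Omega) z.
  congr fine; apply: eq_integral => z _; rewrite !patchE.
  case: ifPn => zr; last first.
    by rewrite zK // !mulr0; case: ifP.
  by rewrite mem_set //; apply: KO; exact: set_mem.
by rewrite E1 E2.
Qed.

End TestFunctions.

(** * Absolute continuity on almost every slice *)

Section Slices.
Context {R : realType}.
Notation mu := (@lebesgue_measure R).
Notation RR := (measurableTypeR R * measurableTypeR R)%type.

Lemma ae_forall_count d (T : measurableType d) (nu : {measure set T -> \bar R})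
    (I : countType) (P : I -> T -> Prop) :
  (forall i, {ae nu, forall x, P i x}) -> {ae nu, forall x, forall i, P i x}.
Proof.
move=> H; have := @ae_foralln _ T R nu
  (fun n x => if @unpickle I n is Some i then P i x else True).
case=> [n|A [mA A0 sA]].
  by case: (unpickle n) => [i|]; [exact: H|exact: aeW].
exists A; split => // x /= nP; apply: sA => /= h; apply: nP => i.
by have := h (pickle i); rewrite pickleK.
Qed.

Lemma integrable_swap (f : R * R -> R) : (leb2 R).-integrable setT (EFin \o f) ->
  (leb2 R).-integrable setT (EFin \o (fun z => f (z.2, z.1))).
Proof.
move=> intf; have mf := measurable_int _ intf.
apply/integrable12ltyP => /=.
  have ms : measurable_fun setT (fun z : RR => (z.2, z.1) : RR).
    by apply: measurable_fun_pair; [exact: measurable_snd|exact: measurable_fst].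
  exact: (measurableT_comp mf ms).
exact: (integrable21ltyP _ _ mf).1 intf.
Qed.

Lemma Rintegral_swap (f : R * R -> R) : (leb2 R).-integrable setT (EFin \o f) ->
  \int[leb2 R]_z f (z.2, z.1) = \int[leb2 R]_z f z.
Proof.
move=> intf; rewrite -(Rfubini1 (integrable_swap intf)).
exact: (Rfubini2 intf).
Qed.

Lemma ae_itv_exists (P : R -> Prop) (a b : R) : a < b ->
  {ae mu, forall x, x \in `]a, b[ -> P x} -> exists2 x, x \in `]a, b[ & P x.
Proof.
move=> ab [N [mN N0 sN]]; apply: contrapT => H.
have mI : measurable (`]a, b[ : set R) by exact: measurable_itv.
have : (mu `]a, b[ <= mu N)%E.
  apply: le_measure; rewrite ?inE // => x xab; apply: sN => /= h.
  by apply: H; exists x => //; exact: h.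
by rewrite N0 lebesgue_measure_itv /= lte_fin ab lee_fin leNgt subr_gt0 ab.
Qed.

(** No integral is computed: if all bumps with rational end points in the interval had integral
    zero, the indicator of []a, b[] would vanish almost everywhere on []a, b[]. A bump of nonzero
    integral is then rescaled. *)
Lemma exists_unit_bump (a b : R) : a < b -> exists th : R -> R,
  [/\ smooth th, mu.-integrable setT (EFin \o th),
      exists C, forall x, `|th x| <= C, forall x, x \notin `]a, b[ -> th x = 0
    & \int[mu]_x th x = 1].
Proof.
move=> ab.
have [n [s [t [as_ st tb I0]]]] : exists n (s t : rat),
  [/\ a <= ratr s, ratr s < ratr t :> R, ratr t <= b &
    \int[mu]_x bump n (ratr s) (ratr t) x != 0].
  apply: contrapT => H.
  have : {ae mu, forall x, x \in `]a, b[ -> (\1_(`]a, b[) : R -> R) x = 0}.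
    apply: bump_orthogonal_ae0; first exact: integrable_indic_itv.
    move=> n s t as_ st tb.
    apply: contrapT => /eqP I0; apply: H; exists n, s, t; split => //.
    apply: contra I0 => /eqP <-; apply/eqP; congr fine; apply: eq_integral => x _.
    congr EFin; rewrite indicE; have [xab|xab] := boolP (x \in `]a, b[).
      by rewrite mem_set // mul1r.
    by rewrite (bump_outS n as_ tb xab) mulr0.
  move/(ae_itv_exists ab) => [x xab].
  by rewrite indicE mem_set // => /eqP; rewrite oner_eq0.
set p := bump n (ratr s) (ratr t) in I0; set c := \int[mu]_x _ in I0.
have ip : mu.-integrable setT (EFin \o p) by exact: bump_integrable.
exists (fun x => c^-1 * p x); split.
- by apply: smoothM; [exact: smooth_cst|exact: (@smooth_bump R n (ratr s) (ratr t))].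
- exact: integrableRZl.
- exists `|c^-1| => x; rewrite normrM -[leRHS]mulr1 ler_wpM2l //.
  by rewrite ger0_norm ?bump_ge0 ?bump_le1.
- by move=> x xab; rewrite /p (bump_outS n as_ tb xab) mulr0.
- by rewrite RintegralZl // mulVf.
Qed.

(** Mean zero makes the primitive vanish to the right of [b] as well, so that it can serve as a
    factor of a test function with derivative [q]. *)
Lemma primitive_test (q : R -> R) (a b : R) : smooth q ->
  mu.-integrable setT (EFin \o q) -> (forall x, x \notin `]a, b[ -> q x = 0) ->
  \int[mu]_x q x = 0 ->
  [/\ smooth (primitive q), forall x : R, is_derive x 1 (primitive q) (q x)
    & forall x, x \notin `]a, b[ -> primitive q x = 0].
Proof.
move=> sq iq zq q0.
have D (x : R) : is_derive x 1 (primitive q) (q x).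
  have iS : mu.-integrable [set` Interval -oo%O (BRight (x + 1))] (EFin \o q).
    by apply: integrableS iq => //; exact: measurable_itv.
  have x1 : x < x + 1 by rewrite ltrDl.
  have [||d1 d2] := continuous_FTC1 x1 iS.
  - by rewrite ltNyr.
  - exact: (smooth_continuous sq).
  - by split; [exact: d1|rewrite -derive1E; exact: d2].
split => //; first exact: smooth_antiderivative sq.
move=> x; rewrite in_itv /= negb_and -!leNgt => /orP[xa|bx].
  rewrite /primitive Rintegral_mkcond (_ : _ \_ _ = cst 0).
    by rewrite Rintegral_cst // mul0r.
  apply/funext => t; rewrite patchE; case: ifPn => // /set_mem /=.
  rewrite in_itv /= => tx; apply: zq; rewrite in_itv /= negb_and -leNgt.
  by rewrite (le_trans tx xa).
rewrite -[primitive q x]opprK -[- primitive q x]add0r -q0.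
rewrite -(Rintegral_ge_itv x iq) (_ : (fun t => _) = cst 0).
  by rewrite Rintegral_cst // mul0r oppr0.
apply/funext => t; rewrite indicE; have [xt|xt] := leP x t.
  rewrite zq ?mul0r // in_itv /= negb_and -!leNgt (le_trans bx xt).
  by rewrite orbT.
by rewrite memNset ?mulr0 //=; apply/negP; rewrite -ltNge.
Qed.


(** Testing with [A x * b y] and Fubini's theorem show that [F i], the one-dimensional weak
    derivative identity on the line at [y] for the test [q i], is orthogonal to every bump [b],
    hence zero for almost every [y]. The indices [i] form a countable set, so a single null set of
    lines is discarded. *)
Lemma weak_derivative_slices (V G : R * R -> R) (a0 b0 c0 d0 : R) : a0 < b0 ->
  (leb2 R).-integrable setT (EFin \o V) ->
  (leb2 R).-integrable setT (EFin \o G) ->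
  (forall A q b : R -> R, smooth A -> (forall x : R, is_derive x 1 A (q x)) ->
    smooth q -> smooth b ->
    (forall x, x \notin `]a0, b0[ -> A x = 0) ->
    (forall x, x \notin `]a0, b0[ -> q x = 0) ->
    (forall y, y \notin `]c0, d0[ -> b y = 0) ->
    \int[leb2 R]_z (V z * (q z.1 * b z.2)) =
    - \int[leb2 R]_z (G z * (A z.1 * b z.2))) ->
  {ae mu, forall y, y \in `]c0, d0[ -> exists k, {ae mu, forall x,
    x \in `]a0, b0[ -> V (x, y) = k + primitive (fun t => G (t, y)) x}}.
Proof.
move=> ab iV iG H.
have [th [sth ith [C thC] zth th1]] := exists_unit_bump ab.
pose p (i : nat * rat * rat) := bump i.1.1 (ratr i.1.2 : R) (ratr i.2).
pose q i := fun x => p i x - (\int[mu]_y p i y) * th x.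
pose F i y := \int[mu]_x (V (x, y) * q i x + G (x, y) * primitive (q i) x).
pose adm (i : nat * rat * rat) :=
  [/\ a0 <= ratr i.1.2, ratr i.1.2 < ratr i.2 :> R & ratr i.2 <= b0].
have key i : adm i -> {ae mu, forall y, y \in `]c0, d0[ -> F i y = 0}.
  move=> [as_ st tb].
  have ip : mu.-integrable setT (EFin \o p i) by exact: bump_integrable.
  have sp : smooth (p i) by exact: (@smooth_bump R).
  have p1 x : `|p i x| <= 1 by rewrite ger0_norm ?bump_ge0 ?bump_le1.
  set c := \int[mu]_y p i y in q F *.
  have iq : mu.-integrable setT (EFin \o q i).
    exact: (integrableRB ip (integrableRZl c ith)).
  have sq : smooth (q i).
    have -> : q i = (fun x => p i x + (- c) * th x).
      by apply/funext => x; rewrite mulNr.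
    by apply: smoothD => //; apply: smoothM => //; exact: smooth_cst.
  have zq x : x \notin `]a0, b0[ -> q i x = 0.
    move=> xab; rewrite /q zth // mulr0 subr0.
    exact: bump_outS as_ tb xab.
  have q0 : \int[mu]_x q i x = 0.
    rewrite RintegralB //; last exact: integrableRZl.
    by rewrite RintegralZl // th1 mulr1 subrr.
  have [sA dA zA] := primitive_test sq iq zq q0.
  have mf1 (f : R -> R) : smooth f -> measurable_fun setT (fun z : RR => f z.1).
    by move=> /smooth_measurable mf; exact: (measurableT_comp mf measurable_fst).
  have mf2 (f : R -> R) : smooth f -> measurable_fun setT (fun z : RR => f z.2).
    by move=> /smooth_measurable mf; exact: (measurableT_comp mf measurable_snd).
  have qC x : `|q i x| <= 1 + `|c| * C.
    apply: le_trans (ler_normB _ _) _; rewrite lerD // normrM.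
    by rewrite ler_wpM2l.
  pose h z := V z * q i z.1 + G z * primitive (q i) z.1.
  have iVq := integrable_mul_bounded iV (mf1 _ sq) (fun z => qC z.1).
  have iGA := integrable_mul_bounded iG (mf1 _ sA)
    (fun z => primitive_bounded z.1 iq).
  have ih : (leb2 R).-integrable setT (EFin \o h) by exact: integrableRD.
  apply: bump_orthogonal_ae0; first exact: (integrable_Rfubini2 ih).
  move=> n s t cs st' td; set b := bump n _ _.
  have sb : smooth b by exact: (@smooth_bump R).
  have b1 x : `|b x| <= 1 by rewrite ger0_norm ?bump_ge0 ?bump_le1.
  have zb y : y \notin `]c0, d0[ -> b y = 0.
    by move=> ycd; exact: bump_outS cs td ycd.
  have ihb := integrable_mul_bounded ih (mf2 _ sb) (fun z => b1 z.2).
  have iVqb := integrable_mul_bounded iVq (mf2 _ sb) (fun z => b1 z.2).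
  have iGAb := integrable_mul_bounded iGA (mf2 _ sb) (fun z => b1 z.2).
  (* Moving [b y] into the inner integral needs the slice of [h] to be integrable, which holds for
     almost every [y]. *)
  transitivity (\int[mu]_y \int[mu]_x (h (x, y) * b y)).
    congr fine; apply: ae_eq_integral => //.
    - apply/measurable_EFinP; apply: measurable_funM.
        exact: integrableT_measurable (integrable_Rfubini2 ih).
      exact: smooth_measurable.
    - exact: measurable_int (integrable_Rfubini2 ihb).
    - have := ae_integrable2 ih.
      by apply: filterS => y iy _ /=; rewrite RintegralZr.
  rewrite (Rfubini2 ihb).
  have -> : (fun z => h z * b z.2) =
      (fun z => V z * q i z.1 * b z.2 + G z * primitive (q i) z.1 * b z.2).
    by apply/funext => z; rewrite /h mulrDl.
  rewrite RintegralD //.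
  have := H _ _ _ sA dA sq sb zA zq zb.
  under eq_Rintegral do rewrite mulrA.
  under [X in _ = - X -> _]eq_Rintegral do rewrite mulrA.
  by move=> ->; rewrite addNr.
have key2 : {ae mu, forall y, forall i, adm i -> y \in `]c0, d0[ -> F i y = 0}.
  apply: ae_forall_count => i.
  have [ai|nai] := pselect (adm i); last by apply: aeW => y /nai.
  have := key i ai; by apply: ae_sub => y h _.
have := ae_integrable2 iG; have := ae_integrable2 iV; move: key2.
apply: filterS3; first exact: (ae_filter_ringOfSetsType mu).
move=> y Fy iVy iGy ycd.
apply: (weak_derivative_primitive iVy iGy ith thC th1) => n s t as_ st tb.
exact: (Fy (n, s, t)).
Qed.

End Slices.

(** * Slices of null sets *)

Section NullSlices.
Context {R : realType}.
Notation mu := (@lebesgue_measure R).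
Notation RR := (measurableTypeR R * measurableTypeR R)%type.

Lemma ge0_integral_eq0 d (T : measurableType d) (nu : {measure set T -> \bar R})
    (f : T -> \bar R) : measurable_fun setT f -> (forall x, (0 <= f x)%E) ->
  (\int[nu]_x f x = 0)%E <-> {ae nu, forall x, f x = 0%E}.
Proof.
move=> mf f0.
have E : (\int[nu]_x f x = \int[nu]_x `|f x|)%E.
  by apply: eq_integral => x _; rewrite gee0_abs.
rewrite E (ae_eq_integral_abs nu measurableT mf).
by split; apply: filterS => x //=; apply.
Qed.

Lemma leb2_xsection_eq0 (B : set RR) : measurable B ->
  (leb2 R) B = 0%E <-> {ae mu, forall x, mu (xsection B x) = 0%E}.
Proof.
move=> mB; apply: ge0_integral_eq0; first exact: measurable_fun_xsection.
by move=> x; exact: measure_ge0.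
Qed.

(** The product measure is defined by integrating the sections at the first coordinate; uniqueness
    of the product measure gives the other order. *)
Lemma leb2_ysection_eq0 (B : set RR) : measurable B ->
  (leb2 R) B = 0%E <-> {ae mu, forall y, mu (ysection B y) = 0%E}.
Proof.
move=> mB.
have -> : (leb2 R) B = (mu \x^ mu)%E B.
  by apply: product_measure_unique => // B1 B2 m1 m2; exact: product_measure2E.
apply: ge0_integral_eq0; first exact: measurable_fun_ysection.
by move=> x; exact: measure_ge0.
Qed.

Lemma negligible_xslices (N : set RR) : (leb2 R).-negligible N ->
  {ae mu, forall x, {ae mu, forall y, ~ N (x, y)}}.
Proof.
move=> [B [mB B0 NB]]; have := (leb2_xsection_eq0 mB).1 B0.
apply: ae_sub => x Bx; exists (xsection B x); split => //.
  exact: measurable_xsection.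
by move=> y /= /contrapT Nxy; rewrite /xsection /= inE; exact: NB.
Qed.

Lemma negligible_yslices (N : set RR) : (leb2 R).-negligible N ->
  {ae mu, forall y, {ae mu, forall x, ~ N (x, y)}}.
Proof.
move=> [B [mB B0 NB]]; have := (leb2_ysection_eq0 mB).1 B0.
apply: ae_sub => y By; exists (ysection B y); split => //.
  exact: measurable_ysection.
by move=> x /= /contrapT Nxy; rewrite /ysection /= inE; exact: NB.
Qed.

(** For a measurable [D], null sections in one direction force measure zero in the plane, hence null
    sections in the other direction. *)
Lemma measurable_ae_swap (D : set RR) : measurable D ->
  {ae mu, forall x, {ae mu, forall y, ~ D (x, y)}} ->
  {ae mu, forall y, {ae mu, forall x, ~ D (x, y)}}.
Proof.
move=> mD H; apply: negligible_yslices; exists D; split => //.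
apply/(leb2_xsection_eq0 mD); move: H.
apply: ae_sub => x [B [mB B0 DB]].
apply/eqP; rewrite eq_le measure_ge0 andbT -B0.
apply: le_measure; rewrite ?inE //; first exact: measurable_xsection.
by move=> y; rewrite /xsection /= inE => Dxy; apply: DB => /=.
Qed.

(** The isolated points of any subset of the line are countable, so [A] may be nonmeasurable. *)
Lemma ae_limit_point (A : set R) : {ae mu, forall x, A x -> limit_point A x}.
Proof.
have c0 := countable_lebesgue_measure0 (countable_isolated A).
have mI : measurable (isolated A : set (measurableTypeR R)).
  exact: (countable_measurable (@measurable_set1 R) (countable_isolated A)).
exists (isolated A); split => // x /= /not_implyP[Ax nl].
have : closure A x by exact: subset_closure.
by rewrite closure_isolated_limit_point => -[].
Qed.

End NullSlices.

(** * Horizontality on slices of a graph *)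

Section GraphSlices.
Context {R : realType}.
Notation mu := (@lebesgue_measure R).

(** With a number as value the map is linear in value and parameters together, so [graph_pt k w' e]
    is also the velocity of a graph along a line of direction [e]. *)
Definition graph_pt (k : 'I_3) (c : R) (x : R * R) : 'rV[R]_3 :=
  graph_map k (fun=> c) x.

Lemma is_derive_vec3 (a b c : R -> R) (t a' b' c' : R) :
  is_derive t 1 a a' -> is_derive t 1 b b' -> is_derive t 1 c c' ->
  is_derive t 1 (fun t => vec3 (a t) (b t) (c t)) (vec3 a' b' c').
Proof.
move=> [da <-] [db <-] [dc <-].
have E (j : 'I_3) (i : 'I_1) : (fun t => vec3 (a t) (b t) (c t) i j) =
    [:: a; b; c]`_j.
  by apply/funext => r; rewrite mxE; case: j => [[|[|[|//]]] ?].
have D : derivable (fun t => vec3 (a t) (b t) (c t)) t 1.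
  apply/derivable_mxP => i j; rewrite E.
  case: j => [[|[|[|j]]] j3]; [exact: da|exact: db|exact: dc|].
  by exfalso; move: j3.
split; first exact: D.
rewrite derive_mx //; apply/matrixP => i j; rewrite !mxE E.
by case: j => [[|[|[|//]]] ?] /=; reflexivity.
Qed.

Lemma is_derive_graph_pt k (w : R -> R) (w' s : R) (z e : R * R) :
  is_derive s 1 w w' ->
  is_derive (0 : R) 1 (fun t => graph_pt k (w (s + t)) (z + (s + t) *: e))
    (graph_pt k w' e).
Proof.
move=> dw.
have ds : is_derive (0 : R) 1 (fun t : R => s + t) 1.
  have := is_deriveD (is_derive_cst s (0 : R) (1 : R)) (is_derive_id (0 : R) (1 : R)).
  by rewrite add0r.
have d0 : is_derive (0 : R) 1 (fun t => w (s + t)) w'.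
  by rewrite -[w']mulr1; apply: is_derive1_comp ds _; rewrite addr0.
have da (p q : R) : is_derive (0 : R) 1 (fun t => p + (s + t) * q) q.
  have dp : is_derive (s + 0) 1 (fun x : R => p + x * q) q.
    have -> : (fun x : R => p + x * q) = cst p + q \*: (id : R -> R).
      by apply/funext => x; rewrite /= [x * q]mulrC.
    have := is_deriveD (is_derive_cst p (s + 0) (1 : R))
      (is_deriveZ q (is_derive_id (s + 0) (1 : R))).
    by rewrite add0r [q *: 1]mulr1.
  by have := is_derive1_comp ds dp; rewrite mulr1.
rewrite /graph_pt /graph_map.
case: ifP => _; [|case: ifP => _];
  by apply: is_derive_vec3; [exact: d0 || exact: da..].
Qed.

Lemma slice_horizontal M k (w : R -> R) (w' s : R) (z e : R * R) (A : set R) :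
  C1_surface M -> is_derive s 1 w w' ->
  M (graph_pt k (w s) (z + s *: e)) ->
  tangent_space M (graph_pt k (w s) (z + s *: e)) `<=`
    horizontal_space (graph_pt k (w s) (z + s *: e)) ->
  limit_point A s -> (forall r, A r -> M (graph_pt k (w r) (z + r *: e))) ->
  contact_form (graph_pt k (w s) (z + s *: e)) (graph_pt k w' e) = 0.
Proof.
move=> CM dw Ms TH lA AM.
have dg := is_derive_graph_pt k z e dw.
have g0 : graph_pt k (w (s + 0)) (z + (s + 0) *: e) =
    graph_pt k (w s) (z + s *: e) by rewrite addr0.
have := @velocity_horizontal R M _ _ CM _ _ dg _.
rewrite g0; apply => // r r0.
have [y [ys Ay sy]] := lA _ (nbhsx_ballx s r r0).
exists (y - s); split; first by rewrite subr_eq0.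
  by move: sy; rewrite -ball_normE /= distrC.
by rewrite addrC subrK; exact: AM.
Qed.

(* The sets of parameters over the [M j] need not be measurable: on the slice
   their isolated points are countable, and elsewhere the derivative of the
   graph function is a limit of chords of [M j]. *)
Lemma slice_contact (M : nat -> set 'rV[R]_3) k (u : R * R -> R) (g : R -> R)
    (z e : R * R) (a b c : R) :
  (forall j, C1_surface (M j)) -> mu.-integrable setT (EFin \o g) ->
  {ae mu, forall s, s \in `]a, b[ ->
    u (z + s *: e) = c + primitive g s /\
    exists j, M j (graph_map k u (z + s *: e)) /\
      tangent_space (M j) (graph_map k u (z + s *: e)) `<=`
        horizontal_space (graph_map k u (z + s *: e))} ->
  {ae mu, forall s, s \in `]a, b[ ->
    contact_form (graph_map k u (z + s *: e)) (graph_pt k (g s) e) = 0}.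
Proof.
move=> CM ig H.
pose w s := c + primitive g s.
(* The sets are defined by the primitive [w], not by [u]: the chords must belong to a function
   differentiable at [s], and [u] agrees with [w] only almost everywhere. *)
pose A j : set R := [set s | M j (graph_pt k (w s) (z + s *: e)) /\
  tangent_space (M j) (graph_pt k (w s) (z + s *: e)) `<=`
        horizontal_space (graph_pt k (w s) (z + s *: e))].
have L : {ae mu, forall s, forall j, A j s -> limit_point (A j) s}.
  by apply: ae_foralln => j; exact: ae_limit_point.
have intS (D : set R) : measurable D -> mu.-integrable D (EFin \o g).
  by move=> mD; apply: integrableS ig.
have F := @FTC1Ny R g (fun y => intS _ (measurable_itv _))
  (open_integrable_locally openT ig).
apply: ae_sub (ae_and (ae_and L F) H) => s [[Ls [dF Fs]] Hs] sab.
have [us [j [Mj Tj]]] := Hs sab.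
have E : graph_map k u (z + s *: e) = graph_pt k (w s) (z + s *: e).
  by rewrite /graph_pt /graph_map us.
rewrite E in Mj Tj *.
apply: (slice_horizontal (CM j) _ Mj Tj (Ls j _)) => [||r []//]; last by split.
rewrite -[g s]add0r; apply: is_deriveD.
by split; [exact: dF|rewrite -derive1E].
Qed.

End GraphSlices.

(** * Incompatibility of the two slice relations *)

Section Contradiction.
Context {R : realType}.
Notation mu := (@lebesgue_measure R).
Notation RR := (measurableTypeR R * measurableTypeR R)%type.

Lemma derive_eq_limit_point (f g : R -> R) (x df dg : R) (A : set R) :
  is_derive x 1 f df -> is_derive x 1 g dg -> A x -> limit_point A x ->
  (forall y, A y -> f y = g y) -> df = dg.
Proof.
move=> Df Dg Ax lA fg.
have [Dh dh] := is_deriveB Df Dg.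
have h0 y : A y -> (f - g) y = 0 by move=> /fg; rewrite /GRing.add /= => ->; exact: subrr.
apply/eqP; rewrite -subr_eq0 -normr_eq0 eq_le normr_ge0 andbT.
apply/ler_addgt0Pr => e e0; rewrite add0r.
have /cvg_ex[l fl] := Dh.
have El : df - dg = l by rewrite -dh; apply: cvg_lim.
move/cvgrPdist_le : fl => /(_ _ e0) /nbhs_ballP[r r0 H].
have [y [ys Ay sy]] := lA _ (nbhsx_ballx x r r0).
have := H (y - x); rewrite /= [_ *: 1]mulr1 subrK !h0 // subrr scaler0 subr0 El.
apply; last by rewrite subr_eq0.
by move: sy; rewrite -!ball_normE /= sub0r normrN distrC.
Qed.

(* The additive constant is recovered from a mean over [y], hence depends
   measurably on [x], so that Tonelli's theorem exchanges the quantifiers. *)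
Lemma ae_slices_swap (v : R * R -> R) (al : R -> R) (a0 b0 c0 d0 : R) :
  c0 < d0 -> (leb2 R).-integrable setT (EFin \o v) ->
  measurable_fun setT al ->
  {ae mu, forall x, x \in `]a0, b0[ -> exists k, {ae mu, forall y,
     y \in `]c0, d0[ -> v (x, y) = k + al x * y}} ->
  exists m : R -> R, {ae mu, forall y, y \in `]c0, d0[ -> {ae mu, forall x,
     x \in `]a0, b0[ -> v (x, y) = m x + al x * y}}.
Proof.
move=> cd iv mal H.
pose J : R -> R := \1_(`]c0, d0[).
have JE y : J y = if y \in `]c0, d0[ then 1 else 0.
  rewrite /J indicE; have [yc|yc] := boolP (y \in `]c0, d0[).
    by rewrite mem_set.
  by rewrite memNset //; exact/negP.
have mJ : measurable_fun setT J by apply: measurable_indic; exact: measurable_itv.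
have iJ : mu.-integrable setT (EFin \o J) by exact: integrable_indic_itv.
have J1 x : `|J x| <= 1 by rewrite JE; case: ifP; rewrite ?normr0 ?normr1.
pose L := \int[mu]_y J y; pose Q := \int[mu]_y (J y * (y * J y)).
have L0 : L != 0.
  have E : (\int[mu]_y (J y)%:E = mu `]c0, d0[)%E by rewrite integral_indic // setIT.
  have E2 : mu `]c0, d0[ = (d0 - c0)%:E.
    by rewrite lebesgue_measure_itv /= lte_fin cd.
  by rewrite /L /Rintegral E E2 /= subr_eq0 gt_eqF.
have iQ : mu.-integrable setT (EFin \o (fun y => J y * (y * J y))).
  apply: (integrable_mul_bounded iJ (C := `|c0| + `|d0|)).
    by apply: measurable_funM => //; exact: measurable_id.
  move=> y; rewrite JE; case: ifPn => [|_]; last by rewrite mulr0 normr0 addr_ge0.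
  rewrite in_itv /= mulr1 => /andP[cy yd]; rewrite ler_norml.
  have := ler_norm c0; have := ler_norm (- c0); have := ler_norm d0.
  have := normr_ge0 c0; have := normr_ge0 d0; rewrite normrN => *.
  by apply/andP; split; lra.
have mJ2 : measurable_fun setT (fun z : RR => J z.2).
  exact: (measurableT_comp mJ measurable_snd).
have ivJ := integrable_mul_bounded iv mJ2 (fun z => J1 z.2).
pose I x := \int[mu]_y (v (x, y) * J y).
(* Integrating [k + al x * y] over []c0, d0[] gives [I x = k * L + al x * Q], solved here for [k].
   The second factor [J] in [Q] makes the multiplier [y * J y] bounded. *)
pose m x := (I x - al x * Q) / L; exists m.
have mI : measurable_fun setT I by exact: integrableT_measurable (integrable_Rfubini1 ivJ).
have key : {ae mu, forall x, x \in `]a0, b0[ -> {ae mu, forall y,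
    y \in `]c0, d0[ -> v (x, y) = m x + al x * y}}.
  apply: ae_sub (ae_and (ae_integrable1 ivJ) H) => x [ix Hx] xab.
  have [k Hk] := Hx xab; apply: (ae_sub _ Hk) => y Hy ycd; rewrite (Hy ycd).
  congr (_ + _); rewrite /m.
  have -> : I x = k * L + al x * Q.
    have ikJ := integrableRZl k iJ; have iaQ := integrableRZl (al x) iQ.
    rewrite -RintegralZl // -[al x * Q]RintegralZl // -RintegralD //.
    congr fine; apply: ae_eq_integral => //.
    - exact: measurable_int ix.
    - exact: measurable_int (integrableRD ikJ iaQ).
    - apply: (ae_sub _ Hk) => z Hz _ /=; rewrite JE; case: ifPn => [zcd|_].
        by rewrite (Hz zcd); congr EFin; ring.
      by rewrite !mulr0 addr0.
  by rewrite addrK mulfK.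
pose D : set RR := [set z | (z.1 \in `]a0, b0[) /\ (z.2 \in `]c0, d0[) /\
  v z != m z.1 + al z.1 * z.2].
have mm : measurable_fun setT m.
  apply: measurable_funM => //; apply: measurable_funB => //.
  exact: measurable_funM.
have mD : measurable D.
  have -> : D = `]a0, b0[ `*` `]c0, d0[ `&`
      (fun z : RR => v z - (m z.1 + al z.1 * z.2)) @^-1` (~` [set 0]).
    apply/seteqP; split => [z [z1 [z2 z3]]|z [[z1 z2] z3]].
      by split => //=; apply/eqP; rewrite subr_eq0.
    by split => //; split => //; rewrite -subr_eq0; exact/eqP.
  apply: measurableI; first by apply: measurableX; exact: measurable_itv.
  rewrite -[X in measurable X]setTI.
  have mf : measurable_fun setT (fun z : RR => v z - (m z.1 + al z.1 * z.2)).
    apply: measurable_funB; first exact: integrableT_measurable iv.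
    apply: measurable_funD; first exact: (measurableT_comp mm measurable_fst).
    apply: measurable_funM; last exact: measurable_snd.
    exact: (measurableT_comp mal measurable_fst).
  by apply: mf => //; apply: measurableC; exact: measurable_set1.
have := @measurable_ae_swap R D mD _.
have DH : {ae mu, forall x, {ae mu, forall y, ~ D (x, y)}}.
  apply: ae_sub key => x Hx.
  have [xab|nxab] := pselect (x \in `]a0, b0[); last first.
    by apply: aeW => y [/nxab].
  by apply: ae_sub (Hx xab) => y Hy [_ [ycd]]; rewrite (Hy ycd) eqxx.
move=> /(_ DH); apply: ae_sub => y Hy ycd; apply: ae_sub Hy => x nD xab.
by apply: contrapT => /eqP nE; apply: nD; split.
Qed.

(** [rel x y] stands for the contact equation at [(x, y)] in the first direction. In the difference
    of two lines the unknown [m x] cancels, and differentiating in [x] gives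
    [(y - y') * dal x = - (dal x * (y - y'))]. *)
Lemma slices_contradiction (v g1 : R * R -> R) (al dal : R -> R)
    (rel : R -> R -> Prop) (a0 b0 c0 d0 : R) :
  a0 < b0 -> c0 < d0 -> (leb2 R).-integrable setT (EFin \o v) ->
  (leb2 R).-integrable setT (EFin \o g1) ->
  (forall x, x \in `]a0, b0[ -> is_derive x 1 al (dal x)) ->
  (forall x, x \in `]a0, b0[ -> dal x != 0) ->
  (forall x y y', x \in `]a0, b0[ -> rel x y -> rel x y' ->
    v (x, y) - v (x, y') = al x * (y - y') ->
    g1 (x, y) - g1 (x, y') = - (dal x * (y - y'))) ->
  {ae mu, forall y, y \in `]c0, d0[ -> exists k, {ae mu, forall x,
    x \in `]a0, b0[ -> v (x, y) = k + primitive (fun t => g1 (t, y)) x}} ->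
  {ae mu, forall x, x \in `]a0, b0[ -> exists k, {ae mu, forall y,
     y \in `]c0, d0[ -> v (x, y) = k + al x * y}} ->
  {ae mu, forall y, y \in `]c0, d0[ -> {ae mu, forall x,
     x \in `]a0, b0[ -> rel x y}} ->
  False.
Proof.
move=> ab cd iv ig Dal dal0 relP A1 A2 A3.
have mI : measurable (`]a0, b0[ : set (measurableTypeR R)).
  exact: measurable_itv.
pose al' : R -> R := al \_ (`]a0, b0[ : set R).
have al'E x : x \in `]a0, b0[ -> al' x = al x.
  by move=> xab; rewrite /al' patchE mem_set.
have mal : measurable_fun (`]a0, b0[ : set R) al.
  apply: open_continuous_measurable_fun; first exact: interval_open.
  move=> x /set_mem xab; apply/differentiable_continuous/derivable1_diffP.
  by have [] := Dal x xab.
have mal' : measurable_fun setT al' by exact: ((measurable_restrictT _ mI).1 mal).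
have A2' : {ae mu, forall x, x \in `]a0, b0[ -> exists k, {ae mu, forall y,
     y \in `]c0, d0[ -> v (x, y) = k + al' x * y}}.
  by apply: ae_sub A2 => x H xab; rewrite al'E //; exact: H.
have [m Hm'] := ae_slices_swap cd iv mal' A2'.
have Hm : {ae mu, forall y, y \in `]c0, d0[ -> {ae mu, forall x,
     x \in `]a0, b0[ -> v (x, y) = m x + al x * y}}.
  apply: ae_sub Hm' => y H ycd; apply: ae_sub (H ycd) => x E xab.
  by rewrite E // al'E.
pose good y := [/\ mu.-integrable setT (EFin \o (fun x => g1 (x, y))),
  exists k, {ae mu, forall x,
    x \in `]a0, b0[ -> v (x, y) = k + primitive (fun t => g1 (t, y)) x},
  {ae mu, forall x, x \in `]a0, b0[ -> v (x, y) = m x + al x * y} &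
  {ae mu, forall x, x \in `]a0, b0[ -> rel x y}].
have G : {ae mu, forall y, y \in `]c0, d0[ -> good y}.
  apply: ae_sub (ae_and (ae_integrable2 ig) (ae_and A1 (ae_and Hm A3))).
  by move=> y [i [a [b c]]] ycd; split => //; [exact: a|exact: b|exact: c].
(* The two lines are chosen on either side of [e], hence distinct. *)
have [e [ce ed]] : exists e, c0 < e /\ e < d0.
  exists ((c0 + d0) / 2); split; lra.
have [y ycd [iy [k Hk] my ry]] : exists2 y, y \in `]c0, e[ & good y.
  apply: ae_itv_exists => //; apply: ae_sub G => y Gy ye; apply: Gy.
  by move: ye; rewrite !in_itv /= => /andP[-> /lt_trans]; apply.
have [y' ycd' [iy' [k' Hk'] my' ry']] : exists2 y, y \in `]e, d0[ & good y.
  apply: ae_itv_exists => //; apply: ae_sub G => z Gy ye; apply: Gy.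
  by move: ye; rewrite !in_itv /= => /andP[/(lt_trans ce) -> ->].
have yy' : y - y' != 0.
  rewrite subr_eq0 lt_eqF //; move: ycd ycd'; rewrite !in_itv /=.
  by move=> /andP[_ h1] /andP[h2 _]; exact: lt_trans h1 h2.
have FTC (f : R -> R) : mu.-integrable setT (EFin \o f) ->
    {ae mu, forall x, derivable (primitive f) x 1 /\ (primitive f)^`()%classic x = f x}.
  move=> intf; apply: FTC1Ny; last exact: (open_integrable_locally openT intf).
  by move=> z; apply: integrableS intf => //; exact: measurable_itv.
pose Phi x := primitive (fun t => g1 (t, y)) x - primitive (fun t => g1 (t, y')) x.
(* The identity is known for almost every [x] only, so the two derivatives are compared at a limit
   point of [A] instead of on a neighbourhood. *)
pose A : set R := [set x | (y - y') * al x - (k - k') = Phi x].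
have [x xab []] : exists2 x, x \in `]a0, b0[ & False.
have := ae_and (ae_and (ae_and Hk Hk') (ae_and my my'))
  (ae_and (ae_and ry ry') (ae_and (ae_limit_point A) (ae_and (FTC _ iy) (FTC _ iy')))).
move=> AE; apply: (ae_itv_exists ab); apply: ae_sub AE.
move=> x [[[h1 h2] [h3 h4]] [[h5 h6] [h7 [[f1 f1'] [f2 f2']]]]] xab.
have Ax : A x.
  rewrite /A /Phi /=; have := h1 xab; have := h2 xab.
  by rewrite (h3 xab) (h4 xab) => e1 e2; lra.
have vv : v (x, y) - v (x, y') = al x * (y - y').
  by rewrite (h3 xab) (h4 xab); ring.
have gg := relP _ _ _ xab (h5 xab) (h6 xab) vv.
have d1 : is_derive x 1 Phi (g1 (x, y) - g1 (x, y')).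
  apply: is_deriveB.
    by split; [exact: f1|rewrite -derive1E; exact: f1'].
  by split; [exact: f2|rewrite -derive1E; exact: f2'].
have d2 : is_derive x 1 (fun x => (y - y') * al x - (k - k')) ((y - y') * dal x).
  have := is_deriveB (is_deriveZ (y - y') (Dal x xab)) (is_derive_cst (k - k') x (1 : R)).
  by rewrite subr0.
have := derive_eq_limit_point d2 d1 Ax (h7 Ax) (fun z Az => Az).
rewrite gg => E.
have : (y - y') * dal x = 0 by lra.
by move/eqP; rewrite mulf_eq0 (negbTE yy') (negbTE (dal0 _ xab)).
Qed.

End Contradiction.

(** * Horizontal graphs do not exist *)

Section Nonexistence.
Context {R : realType}.
Notation mu := (@lebesgue_measure R).
Notation RR := (measurableTypeR R * measurableTypeR R)%type.

Lemma contact_form_graph k (v x y g e1 e2 : R) :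
  contact_form (graph_pt k v (x, y)) (graph_pt k g (e1, e2)) =
  if k == 0 then e2 + x * g - v * e1
  else if k == 1 then e2 + v * e1 - x * g
  else g + y * e1 - x * e2.
Proof.
rewrite /graph_pt /graph_map /contact_form; case: (k == 0).
  by rewrite !mxE.
by case: (k == 1); rewrite !mxE.
Qed.

(* The second partial derivative of the function of a horizontal graph depends
   on the first parameter alone. *)
Definition slope (k : 'I_3) (x : R) : R :=
  if k == 0 then - x^-1 else if k == 1 then x^-1 else x.

Definition dslope (k : 'I_3) (x : R) : R :=
  if k == 0 then x ^- 2 else if k == 1 then - x ^- 2 else 1.

Lemma is_derive_slope k (x : R) : x != 0 ->
  is_derive x 1 (slope k) (dslope k x).
Proof.
move=> x0.
have dV := is_derive_inv x0.
rewrite /slope /dslope; case: (k == 0).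
  by have := is_deriveN dV; rewrite opprK.
by case: (k == 1); [exact: dV|exact: is_derive_id].
Qed.

Lemma dslope_neq0 k (x : R) : x != 0 -> dslope k x != 0.
Proof.
move=> x0; rewrite /dslope; case: (k == 0); first by rewrite invr_eq0 expf_neq0.
by case: (k == 1); rewrite ?oner_neq0 // oppr_eq0 invr_eq0 expf_neq0.
Qed.

(** In the direction [(0, 1)] both [v] and [y] drop out of the contact equation, which reads
    [1 + x g = 0], [1 - x g = 0] or [g = x] according to [k]. *)
Lemma contact_form_slope k (v x y g : R) : x != 0 ->
  contact_form (graph_pt k v (x, y)) (graph_pt k g (0, 1)) = 0 -> g = slope k x.
Proof.
move=> x0; rewrite contact_form_graph /slope.
case: (k == 0); [|case: (k == 1)] => E.
- by apply: (mulfI x0); rewrite mulrN mulfV //; lra.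
- by apply: (mulfI x0); rewrite mulfV //; lra.
- lra.
Qed.

(** In the direction [(1, 0)] the contact equation is [x g = v] for [k = 0] and [k = 1], and
    [g = - y] otherwise. In all three cases the sign is opposite to that obtained by differentiating
    the hypothesis on [v - v']. *)
Lemma contact_form_diff k (v v' x y y' g g' : R) : x != 0 ->
  contact_form (graph_pt k v (x, y)) (graph_pt k g (1, 0)) = 0 ->
  contact_form (graph_pt k v' (x, y')) (graph_pt k g' (1, 0)) = 0 ->
  v - v' = slope k x * (y - y') ->
  g - g' = - (dslope k x * (y - y')).
Proof.
move=> x0; rewrite !contact_form_graph /slope /dslope.
case: (k == 0); [|case: (k == 1)] => E1 E2 E3.
- apply: (mulfI x0); rewrite (_ : x * (g - g') = v - v'); last by lra.
  by rewrite E3; field.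
- apply: (mulfI x0); rewrite (_ : x * (g - g') = v - v'); last by lra.
  by rewrite E3; field.
- lra.
Qed.

(** Balls of the product norm are squares. The rectangle lies to the right of the centre when
    [0 <= x] and to its left otherwise, which keeps it away from the axis [x = 0]. *)
Lemma open_contains_rectangle (Omega : set (R * R)) :
  open Omega -> Omega !=set0 -> exists a0 b0 c0 d0 : R,
    [/\ a0 < b0, c0 < d0, forall x, x \in `[a0, b0] -> x != 0 &
        rectangle a0 b0 c0 d0 `<=` Omega].
Proof.
move=> oO [[x y] Oxy].
have /nbhs_ballP[r r0 H] : nbhs (x, y) Omega by exact: open_nbhs_nbhs.
have r0' : 0 < r by exact: r0.
have sub a0 b0 : x - r < a0 -> b0 < x + r ->
    rectangle a0 b0 (y - r / 2) (y + r / 2) `<=` Omega.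
  move=> xa bx [z1 z2] [] /=; rewrite !in_itv /= => /andP[az zb] /andP[cz zd].
  apply: H; split; rewrite -ball_normE /= ltr_norml; apply/andP; split; lra.
have [x0|x0] := leP 0 x.
  exists (x + r / 4), (x + r / 2), (y - r / 2), (y + r / 2); split; try lra.
  - by move=> z; rewrite in_itv /= => /andP[az _]; rewrite gt_eqF //; lra.
  - by apply: sub; lra.
exists (x - r / 2), (x - r / 4), (y - r / 2), (y + r / 2); split; try lra.
- by move=> z; rewrite in_itv /= => /andP[_ zb]; rewrite lt_eqF //; lra.
- by apply: sub; lra.
Qed.

Lemma primitive_ae_cst (g : R -> R) (c c0 d0 y : R) :
  mu.-integrable setT (EFin \o g) -> (forall t, t \notin `[c0, d0] -> g t = 0) ->
  {ae mu, forall t, t \in `]c0, d0[ -> g t = c} -> y \in `]c0, d0[ ->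
  primitive g y = c * (y - c0).
Proof.
move=> ig g0 gc; rewrite in_itv /= => /andP[cy yd].
have mI : measurable (`]c0, y] : set (measurableTypeR R)) by exact: measurable_itv.
have mJ : measurable (`]-oo, y] : set (measurableTypeR R)) by exact: measurable_itv.
rewrite /primitive Rintegral_mkcond.
transitivity (\int[mu]_t (cst c \_ (`]c0, y] : set R)) t).
  congr fine; apply: ae_eq_integral => //.
  - apply/measurable_EFinP.
    exact: ((measurable_restrictT _ mJ).1 (measurable_funTS (integrableT_measurable ig))).
  - apply/measurable_EFinP.
    exact: ((measurable_restrictT _ mI).1 (measurable_cst c)).
  (* At [t = c0] neither hypothesis determines [g], so this point is discarded. *)
  - have n0 : {ae mu, forall t : R, t != c0}.
      exists [set c0]; split => //; first exact: lebesgue_measure_set1.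
      by move=> t /= /negP; rewrite negbK => /eqP.
    apply: ae_sub (ae_and n0 gc) => t [tc Ht] _ /=; congr EFin.
    rewrite !patchE; have [ty|yt] := leP t y; last first.
      by rewrite !memNset //= in_itv /= ?(leNgt t y) ?yt ?andbF.
    rewrite mem_set /= ?in_itv //.
    have [ct|tc'] := ltP c0 t.
      rewrite mem_set /= ?in_itv /= ?ct ?ty // Ht // in_itv /= ct.
      exact: le_lt_trans yd.
    rewrite memNset /= ?in_itv /= ?(ltNge c0 t) ?tc' // g0 // in_itv /=.
    by rewrite leNgt lt_neqAle tc tc'.
rewrite -Rintegral_mkcond Rintegral_cst //; congr (_ * _).
have E : mu `]c0, y] = (y - c0)%:E.
  by rewrite lebesgue_measure_itv /= lte_fin cy.
by rewrite -[RHS]/(fine (y - c0)%:E) -E.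
Qed.


Lemma bounded_compact_support (f : R -> R) (a b : R) :
  continuous f -> (forall x, x \notin `]a, b[ -> f x = 0) ->
  exists C, forall x, `|f x| <= C.
Proof.
move=> cf f0.
have /compact_bounded[C [_ HC]] : compact (f @` `[a, b]).
  by apply: continuous_compact; [exact: continuous_subspaceT|exact: segment_compact].
exists (`|C| + 1) => x; have [xab|/f0->] := boolP (x \in `]a, b[).
  apply: (HC (`|C| + 1)); first by rewrite (le_lt_trans (ler_norm C)) // ltrDl.
  by exists x => //; exact: subset_itv_oo_cc.
by rewrite normr0 addr_ge0.
Qed.

(** The problem is localized to a closed rectangle in [Omega], off which the Borel representative
    and its weak derivatives are set to 0; they become integrable in the plane. *)
Lemma no_horizontal_graph (Omega : set (R * R)) (u : R * R -> R) (k : 'I_3)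
    (M : nat -> set 'rV[R]_3) :
  open Omega -> Omega !=set0 -> sobolev11_loc Omega u ->
  (forall j, C1_surface (M j)) ->
  (leb2 R).-negligible [set z | Omega z /\ ~ exists j,
    M j (graph_map k u z) /\ tangent_space (M j) (graph_map k u z) `<=`
      horizontal_space (graph_map k u z)] ->
  False.
Proof.
move=> oO O0 [v [g1 [g2 [uv [iv i1 i2] w1 w2]]]] CM Hneg.
have [a0 [b0 [c0 [d0 [ab cd nz KO]]]]] := open_contains_rectangle oO O0.
set K := rectangle a0 b0 c0 d0 in KO.
have cK : compact K by exact: compact_rectangle.
have mK : measurable (K : set RR) by exact: measurable_rectangle.
have intK (f : R * R -> R) : loc_integrable Omega f ->
    (leb2 R).-integrable setT (EFin \o (f \_ K)).
  by move=> /(_ K cK KO); rewrite (integrable_mkcond _ mK) restrict_EFin.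
have iV := intK _ iv; have iG1 := intK _ i1; have iG2 := intK _ i2.
have inK x y : x \in `]a0, b0[ -> y \in `]c0, d0[ -> K (x, y).
  by move=> xab ycd; split; exact: subset_itv_oo_cc.
set V := v \_ K in iV *; set G1 := g1 \_ K in iG1; set G2 := g2 \_ K in iG2.
have A1 := weak_derivative_slices ab iV iG1
  (fun A q b sA dA _ sb zA zq zb =>
    weak_derivative_tensor1 w1 KO sA dA sb zA zq zb).
(* The second direction is the first one for the functions with swapped arguments; [swapE] then
   undoes the swap in the integrals. *)
have S2 := weak_derivative_slices (c0 := a0) (d0 := b0) cd
  (integrable_swap iV) (integrable_swap iG2).
have {}S2 : {ae mu, forall x, x \in `]a0, b0[ -> exists k, {ae mu, forall y,
    y \in `]c0, d0[ -> V (x, y) = k + primitive (fun t => G2 (x, t)) y}}.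
  apply: S2 => A q b sA dA sq sb zA zq zb.
  have swapE (f : R * R -> R) (p : R -> R) :
      (leb2 R).-integrable setT (EFin \o f) -> smooth p ->
      (forall y, y \notin `]c0, d0[ -> p y = 0) ->
      \int[leb2 R]_z (f (z.2, z.1) * (p z.1 * b z.2)) =
      \int[leb2 R]_z (f z * (b z.1 * p z.2)).
    move=> intf sp zp.
    have [Cb bC] := bounded_compact_support (smooth_continuous sb) zb.
    have [Cp pC] := bounded_compact_support (smooth_continuous sp) zp.
    have mbp : measurable_fun setT (fun z : RR => b z.1 * p z.2).
      apply: measurable_funM.
        exact: (measurableT_comp (smooth_measurable sb) measurable_fst).
      exact: (measurableT_comp (smooth_measurable sp) measurable_snd).
    have bnd (z : RR) : `|b z.1 * p z.2| <= Cb * Cp by rewrite normrM ler_pM.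
    rewrite -(Rintegral_swap (integrable_mul_bounded intf mbp bnd)).
    by congr fine; apply: eq_integral => z _; rewrite /= [p _ * _]mulrC.
  rewrite (swapE V q) // (swapE G2 A) //.
  exact: (weak_derivative_tensor2 w2 KO sb sA dA zb zA zq).
pose good z := u z = V z /\ exists j,
    M j (graph_map k u z) /\ tangent_space (M j) (graph_map k u z) `<=`
      horizontal_space (graph_map k u z).
(* There are two sources of exceptions: [u] differs from its Borel representative, or no surface
   [M j] with horizontal tangent space passes through the point. *)
have Nneg : (leb2 R).-negligible [set z | (z.1 \in `]a0, b0[) /\
    (z.2 \in `]c0, d0[) /\ ~ good z].
  apply: negligibleS (negligibleU uv Hneg) => -[x y] /= [xab [ycd ng]].
  have Kxy := inK _ _ xab ycd; have Oxy := KO _ Kxy.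
  have [E|nE] := pselect (u (x, y) = v (x, y)); last first.
    by left => /= /(_ Oxy).
  right; split => // gd; apply: ng; split => //.
  by rewrite /V patchE mem_set.
pose rel x y := u (x, y) = V (x, y) /\
  contact_form (graph_map k u (x, y)) (graph_pt k (G1 (x, y)) (1, 0)) = 0.
have nzo x : x \in `]a0, b0[ -> x != 0.
  by move=> xab; apply: nz; exact: subset_itv_oo_cc.
apply: (@slices_contradiction R V G1 (slope k) (dslope k) rel a0 b0 c0 d0) => //.
- by move=> x /nzo; exact: is_derive_slope.
- by move=> x /nzo; exact: dslope_neq0.
- move=> x y y' /nzo x0 [uy cy] [uy' cy'] vv; rewrite -uy -uy' in vv.
  exact: (contact_form_diff x0 cy cy' vv).
- apply: ae_sub (ae_and (negligible_xslices Nneg) (ae_and S2 (ae_integrable1 iG2))).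
  move=> x [Nx [Sx ix]] xab; have [c Hc] := Sx xab.
  have E s : (x, 0) + s *: (0, 1) = (x, s) :> R * R.
    by congr (_, _); rewrite /= ?scaler0 ?addr0 // add0r [_ *: _]mulr1.
  have := @slice_contact R M k u (fun t => G2 (x, t)) (x, 0) (0, 1) c0 d0 c CM ix _.
  have H : {ae mu, forall s, s \in `]c0, d0[ ->
      u ((x, 0) + s *: (0, 1)) = c + primitive (fun t => G2 (x, t)) s /\
      exists j, M j (graph_map k u ((x, 0) + s *: (0, 1))) /\
        tangent_space (M j) (graph_map k u ((x, 0) + s *: (0, 1))) `<=`
          horizontal_space (graph_map k u ((x, 0) + s *: (0, 1)))}.
    apply: ae_sub (ae_and Nx Hc) => y [ny Hy] ycd; rewrite E.
    have [uy gy] : good (x, y) by apply: contrapT => ng; apply: ny.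
    by split => //; rewrite uy; exact: Hy.
  move=> /(_ H) {}H.
  have sl : {ae mu, forall y, y \in `]c0, d0[ -> G2 (x, y) = slope k x}.
    apply: ae_sub H => y Hy ycd; have := Hy ycd; rewrite E.
    exact: (contact_form_slope (nzo _ xab)).
  have z2 t : t \notin `[c0, d0] -> G2 (x, t) = 0.
    by move=> tn; rewrite /G2 patchE memNset // => -[_ /=]; exact/negP.
  (* The primitive of the constant [slope k x] starts at [c0], where the cut-off derivative begins,
     so [V (x, y) = c + slope k x * (y - c0)]. *)
  exists (c - slope k x * c0); apply: (ae_sub _ Hc) => y Hy ycd.
  by rewrite (Hy ycd) (primitive_ae_cst ix z2 sl ycd); ring.
- apply: ae_sub (ae_and (negligible_yslices Nneg) (ae_and A1 (ae_integrable2 iG1))).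
  move=> y [Ny [Sy iy]] ycd; have [c Hc] := Sy ycd.
  have E s : (0, y) + s *: (1, 0) = (s, y) :> R * R.
    by congr (_, _); rewrite /= ?scaler0 ?addr0 // add0r [_ *: _]mulr1.
  have := @slice_contact R M k u (fun t => G1 (t, y)) (0, y) (1, 0) a0 b0 c CM iy _.
  have H : {ae mu, forall s, s \in `]a0, b0[ ->
      u ((0, y) + s *: (1, 0)) = c + primitive (fun t => G1 (t, y)) s /\
      exists j, M j (graph_map k u ((0, y) + s *: (1, 0))) /\
        tangent_space (M j) (graph_map k u ((0, y) + s *: (1, 0))) `<=`
          horizontal_space (graph_map k u ((0, y) + s *: (1, 0)))}.
    apply: ae_sub (ae_and Ny Hc) => x [nx Hx] xab; rewrite E.
    have [ux gx] : good (x, y) by apply: contrapT => ng; apply: nx.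
    by split => //; rewrite ux; exact: Hx.
  move=> /(_ H) {}H; apply: ae_sub (ae_and Ny H) => x [nx Hx] xab.
  have [ux _] : good (x, y) by apply: contrapT => ng; apply: nx.
  by split => //; have := Hx xab; rewrite E.
Qed.

(** This left inverse of the graph map does not depend on [u]; through it null sets of points on the
    surface become null sets of parameters. *)
Lemma graph_map_projection (k : 'I_3) : exists i j : 'I_3,
  forall (u : R * R -> R) z, (graph_map k u z 0 i, graph_map k u z 0 j) = z.
Proof.
rewrite /graph_map; case: (k == 0); [|case: (k == 1)].
- by exists 1, 2 => u [x y]; rewrite !mxE.
- by exists 0, 2 => u [x y]; rewrite !mxE.
- by exists 0, 1 => u [x y]; rewrite !mxE.
Qed.

End Nonexistence.

Theorem theorem1 (R : realType) :
  ~ exists Sigma : set 'rV[R]_3, sobolev_surface Sigma /\ horizontal Sigma.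
Proof.
(* The family is nonempty, and any one of its graphs leads to the contradiction. *)
move=> [S [[_ [J [Om [u [k [[i Ji] gr _ GS]]]]]] [T [[M [CM SM TM]] HT]]]].
have [oO O0 su _] := gr i Ji.
apply: (no_horizontal_graph (k := k i) oO O0 su CM).
have [p [q pqE]] := @graph_map_projection R (k i).
(* The four null sets are the points of the graphs outside [S], those of [S] outside every [M j],
   those of [S] on some [M j] where [T] differs from its tangent space, and those of [S] where [T]
   is not horizontal. *)
have N1 := hausdorff2_null_projection p q GS.
have N2 := hausdorff2_null_projection p q SM.
have N3 := negligible_bigcup (fun j => hausdorff2_null_projection p q (TM j)).
have N4 := hausdorff2_null_projection p q HT.
apply: negligibleS (negligibleU (negligibleU N1 N2) (negligibleU N3 N4)).
move=> z [Oz nH]; set y := graph_map (k i) (u i) z in nH.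
have Gy : (\bigcup_(i in J) (graph_map (k i) (u i) @` Om i)) y.
  by exists i => //; exists z.
have [Sy|nS] := pselect (S y); last first.
  by left; left; exists y; [split|exact: pqE].
have [[j _ Mj]|nM] := pselect ((\bigcup_j M j) y); last first.
  by left; right; exists y; [split|exact: pqE].
have [HTy|nHT] := pselect (T y `<=` horizontal_space y); last first.
  by right; right; exists y; [split|exact: pqE].
have [Ty|nT] := pselect (T y = tangent_space (M j) y); last first.
  by right; left; exists j => //; exists y; [split|exact: pqE].
by exfalso; apply: nH; exists j; rewrite -Ty.
Qed.
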